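(* Let $(\Omega,\mathcal{A},\mu)$ be a Lebesgue space with $\mu$ a probability measure, and let $(T_t)_{t\in\mathbb{R}}$ be a family of maps $T_t:\Omega\to\Omega$ such that $(t,\omega)\mapsto T_t\omega$ is measurable, each $T_t$ is a measure-preserving transformation of $(\Omega,\mathcal{A},\mu)$, and $T_t\circ T_s=T_{t+s}$ for all $t,s\in\mathbb{R}$. Then for every $f\in L^1(\mu)$ there is a single $\mu$-null set $N\subset\Omega$ such that for every $\omega\in\Omega\setminus N$ and every $\theta\in\mathbb{R}$ the limit $$\lim_{\tau\to+\infty}\frac1\tau\int_0^\tau f(T_t\omega)\,e^{2\pi i\theta t}\,dt$$ exists in $\mathbb{C}$.
   Context: A Lebesgue space is a standard probability space. The null set $N$ may depend on $f$ but not on $\theta$. *)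

(* Defs.v *)
From mathcomp Require Export all_boot all_order all_algebra complex.
From mathcomp Require Export all_classical all_reals all_analysis.
From mathcomp Require Export measurable_realfun.

Set Implicit Arguments.
Unset Strict Implicit.
Unset Printing Implicit Defensive.

Export Order.TTheory GRing.Theory Num.Theory.
Export numFieldNormedType.Exports.

Local Open Scope classical_set_scope.
Local Open Scope ring_scope.
Local Open Scope complex_scope.

(* Isomorphism mod 0 of measure spaces: after removing null sets, a bijection
   that is measurable in both directions and preserves the measure.  Both sides
   are compared through their completions: [completed_algebra_gen m] is the
   completed sigma-algebra and the outer measure [m^*] restricts to the
   completed measure on it.  So for complete spaces this is Rokhlin's notion,
   and a standard Borel space and its completion are isomorphic mod 0. *)
Definition isomorphic_mod0 (R : realType) (d1 d2 : measure_display)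
    (T1 : measurableType d1) (T2 : measurableType d2)
    (m1 : set T1 -> \bar R) (m2 : set T2 -> \bar R) : Prop :=
  exists (X1 : set T1) (X2 : set T2) (phi : T1 -> T2),
    [/\ m1.-negligible (~` X1), m2.-negligible (~` X2), set_bij X1 X2 phi &
        forall E : set T1, E `<=` X1 ->
          (completed_algebra_gen m1 E <-> completed_algebra_gen m2 (phi @` E))
          /\ (completed_algebra_gen m1 E ->
              (m1^*)%mu E = (m2^*)%mu (phi @` E))].

(* Lebesgue measure on [0, c] plus atoms of mass p 0, p 1, ... located at the
   points 2, 3, ...; these lie outside [0, c] when c <= 1.  Points with p n = 0
   are null, so finitely many atoms (or none) are covered. *)
Definition interval_with_atoms (R : realType) (c : R) (p : nat -> R)
    (B : set (measurableTypeR R)) : \bar R :=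
  (lebesgue_measure (B `&` `[0%R, c]%classic)
   + \sum_(0 <= n <oo) ((p n)%:E * \d_(n.+2%:R : measurableTypeR R) B))%E.

Definition lebesgue_space (R : realType) (d : measure_display)
    (Omega : measurableType d) (mu : probability Omega R) : Prop :=
  exists (c : R) (p : nat -> R),
    [/\ 0 <= c, forall n, 0 <= p n,
        (c%:E + \sum_(0 <= n <oo) (p n)%:E = 1)%E &
        isomorphic_mod0 mu (interval_with_atoms c p)].

Definition measure_preserving (R : realType) (d : measure_display)
    (Omega : measurableType d) (mu : probability Omega R)
    (S : Omega -> Omega) : Prop :=
  measurable_fun setT S /\
  forall A : set Omega, measurable A -> mu (S @^-1` A) = mu A.

(* Measurability of (t, w) |-> T t w with respect to the completed product
   sigma-algebra on R * Omega.  With Omega complete this is the meaningful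
   reading: Borel(R) (x) A would exclude even the rotation flow of the circle
   with its Lebesgue sigma-algebra.  Maps measurable for the plain product
   sigma-algebra satisfy it a fortiori. *)
Definition jointly_measurable (R : realType) (d : measure_display)
    (Omega : measurableType d) (mu : probability Omega R)
    (T : R -> Omega -> Omega) : Prop :=
  forall A : set Omega, measurable A ->
    completed_algebra_gen (@lebesgue_measure R \x mu)%E
      [set p : measurableTypeR R * Omega | A (T p.1 p.2)].

Definition Cintegrable (R : realType) (d : measure_display)
    (X : measurableType d) (m : {measure set X -> \bar R}) (D : set X)
    (g : X -> R[i]) : Prop :=
  m.-integrable D (fun x => (complex.Re (g x))%:E) /\
  m.-integrable D (fun x => (complex.Im (g x))%:E).

Definition Cintegral (R : realType) (d : measure_display)
    (X : measurableType d) (m : {measure set X -> \bar R}) (D : set X)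
    (g : X -> R[i]) : R[i] :=
  Rintegral m D (fun x => complex.Re (g x))
  +i* Rintegral m D (fun x => complex.Im (g x)).

Definition expi (R : realType) (x : R) : R[i] := cos x +i* sin x.

Definition twisted_orbit (R : realType) (Omega : Type)
    (T : R -> Omega -> Omega) (f : Omega -> R[i]) (w : Omega) (theta : R)
    (t : R) : R[i] :=
  f (T t w) * expi (2 * pi * theta * t).

(* Time integrals are taken against the completed Lebesgue measure, since
   t |-> f (T t w) is in general only Lebesgue measurable for almost every w. *)
Definition twisted_average (R : realType) (Omega : Type)
    (T : R -> Omega -> Omega) (f : Omega -> R[i]) (w : Omega) (theta : R)
    (tau : R) : R[i]^o :=
  (tau^-1)%:C * Cintegral (@completed_lebesgue_measure R) `[0, tau]%classic
                  (twisted_orbit T f w theta).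

(* Main.v *)
From HB Require Import structures.
Require Import Defs.
From mathcomp Require Import ring lra.

Set Implicit Arguments.
Unset Strict Implicit.
Unset Printing Implicit Defensive.

Local Open Scope classical_set_scope.
Local Open Scope ring_scope.

(* A bounded function is treated first, for the time-one map S.  By Birkhoff,
   almost every orbit has autocorrelations, hence a spectral measure (seen
   through [mean_energy] below).  By van der Corput, the twisted averages tend to
   0 at every frequency that is not an atom of it.  By Bessel, atoms of mass at
   least e are isolated, so each of them is the first one after some rational;
   this selects all atoms by countably many measurable functions, which are
   constant along almost every orbit.  At a frequency Theta(x) given by such a
   function, the averages converge by Birkhoff's theorem for the map
   (x, y) |-> (S x, y + Theta(x)) of the product with the circle.  Thus no ergodic
   decomposition is needed.  Integrable functions follow by truncation and the
   maximal inequality.  For the flow, the integral over [0, n] is a sum along an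
   orbit of S of integrals over [0, 1], in which the frequency may be replaced by
   a nearby rational one, uniformly along the orbit; only countably many
   integrable functions are then involved. *)

(** * Cesaro averages of real sequences *)

(** The obstacle is the order of quantifiers: the ergodic theorem gives one null set per function,
    and there are uncountably many frequencies. Van der Corput's bound concerns a single orbit, so
    it costs no further null set. At an atom it says nothing, and the ergodic theorem needs a
    measurable function of the point; as the atoms vary from point to point in a non-ergodic system,
    they have to be selected measurably. The selector must moreover be constant along orbits, for
    otherwise the rotations of the skew product would not add up to [k] times [Theta(x)]; it is
    constant because it depends only on autocorrelations, which forget finitely many terms. In both
    passages to the limit, truncation and change of frequency, the error is controlled by averages
    of absolute values, which do not involve the frequency. Real cosines with an arbitrary phase
    replace complex exponentials until the final theorem; the phases 0 and [- (pi / 2)] recover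
    cosine and sine. *)

Definition cesaro (R : realType) (u : nat -> R) (n : nat) : R :=
  n%:R^-1 * \sum_(k < n) u k.

Section real_sequences.
Context {R : realType}.
Implicit Types (u v : nat -> R).

(** Serves both limit passages: from truncations to an integrable function, and from rational to
    real frequencies inside a block of time. *)
Lemma is_cvg_uniform_approx u :
  (forall e : R, 0 < e -> exists2 v : nat -> R, cvgn v & forall n, `|u n - v n| <= e) ->
  cvgn u.
Proof.
move=> uv; apply/cauchy_cvgP/cauchy_ballP => e e0.
have e4 : 0 < e / 4 by rewrite divr_gt0.
have [v cv uvn] := uv _ e4.
have /cvg_ex [l vl] := cv.
have /cvgrPdist_lt /(_ _ e4) [N _ vN] := vl.
exists (u @` [set n | (N <= n)%N], u @` [set n | (N <= n)%N]) => /=.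
  by split; exists N => // n Nn; exists n.
move=> [_ _] /= [[m Nm <-] [n Nn <-]]; rewrite /ball /=.
have := vN _ Nm; have := vN _ Nn; have := uvn m; have := uvn n.
rewrite !ler_norml !ltr_norml => /andP[? ?] /andP[? ?] /andP[? ?] /andP[? ?].
by apply/andP; split; lra.
Qed.

(** The limit is [sup S], the upper limit. If the sequence dipped infinitely often below
    [sup S - e], two rationals below [sup S] would form a forbidden gap. Rational gaps reduce
    divergence to countably many events. *)
Lemma is_cvg_no_rat_gap u (M : R) : (forall n, `|u n| <= M) ->
  (forall a b : rat, a < b ->
     ~ ((forall N, exists2 n, (N <= n)%N & u n < ratr a) /\
        (forall N, exists2 n, (N <= n)%N & ratr b < u n))) ->
  cvgn u.
Proof.
move=> uM nogap; pose S := [set x : R | forall N, exists2 n, (N <= n)%N & x < u n].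
have S0 : S (- M - 1).
  by move=> N; exists N => //; have := uM N; rewrite ler_norml => /andP[? _]; lra.
have hS : has_sup S.
  split; first by exists (- M - 1).
  exists M => x /(_ 0%N) [n _ xn].
  by have := uM n; rewrite ler_norml => /andP[_ ?]; lra.
apply/cvg_ex; exists (sup S); apply/cvgrPdist_le => e e0.
have up : exists N, forall n, (N <= n)%N -> u n <= sup S + e.
  apply: contrapT => /forallNP H.
  have : S (sup S + e).
    move=> N; have /existsNP [n /not_implyP [Nn /negP]] := H N.
    by rewrite -ltNge => ?; exists n.
  by move=> /(sup_upper_bound hS); lra.
have [a ae] := @rat_in_itvoo R (sup S - e) (sup S) ltac:(lra).
have [b bb] := @rat_in_itvoo R (ratr a) (sup S)
  ltac:(by move: ae; rewrite in_itv/= => /andP[]).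
move: ae bb; rewrite !in_itv/= => /andP[ae aS] /andP[ab bS].
have [x Sx bx] := sup_gt hS.1 bS.
have lo : exists N, forall n, (N <= n)%N -> sup S - e <= u n.
  apply: contrapT => /forallNP H.
  apply: (nogap a b); first by move: ab; rewrite ltr_rat.
  split.
    move=> N; have /existsNP [n /not_implyP [Nn /negP]] := H N.
    by rewrite -ltNge => ?; exists n => //; lra.
  by move=> N; have [n Nn xn] := Sx N; exists n => //; lra.
case: up => N1 h1; case: lo => N2 h2.
exists (maxn N1 N2) => // n /=; rewrite geq_max => /andP[/h1 ? /h2 ?].
by rewrite ler_distl; apply/andP; split; lra.
Qed.


Lemma cvg_sum (I : Type) (r : seq I) (F : I -> nat -> R) (l : I -> R) :
  (forall i, F i @ \oo --> l i) ->
  (fun n => \sum_(i <- r) F i n) @ \oo --> \sum_(i <- r) l i.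
Proof.
move=> Fl; elim: r => [|i r IH].
  rewrite big_nil; under eq_fun do rewrite big_nil.
  exact: cvg_cst.
rewrite big_cons/=; under eq_fun do rewrite big_cons/=.
exact: cvgD.
Qed.

Lemma cesaro_sum (I : Type) (r : seq I) (F : I -> nat -> R) n :
  cesaro (fun k => \sum_(i <- r) F i k) n = \sum_(i <- r) cesaro (F i) n.
Proof. by rewrite /cesaro exchange_big/= mulr_sumr. Qed.

Lemma cesaroZl a u n : cesaro (fun k => a * u k) n = a * cesaro u n.
Proof. by rewrite /cesaro -mulr_sumr mulrCA. Qed.

Lemma cesaroB u v n : cesaro (fun k => u k - v k) n = cesaro u n - cesaro v n.
Proof. by rewrite /cesaro sumrB mulrBr. Qed.

Lemma le_cesaro u v n : (forall k, u k <= v k) -> cesaro u n <= cesaro v n.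
Proof.
by move=> uv; rewrite /cesaro ler_wpM2l ?invr_ge0//; apply: ler_sum => k _.
Qed.

Lemma le_normr_cesaro u n : `|cesaro u n| <= cesaro (fun k => `|u k|) n.
Proof.
by rewrite /cesaro normrM ger0_norm ?invr_ge0// ler_wpM2l ?invr_ge0// ler_norm_sum.
Qed.

(** Only an inequality: at [n = 0] the average is 0. *)
Lemma cesaro_cst_le (a : R) n : 0 <= a -> cesaro (fun=> a) n <= a.
Proof.
move=> a0; rewrite /cesaro sumr_const card_ord -(mulr_natl a).
have [->|n0] := eqVneq n 0%N; first by rewrite !mul0r mulr0.
by rewrite mulKf// pnatr_eq0.
Qed.

Lemma le_normr_cesaro_bounded u M n : (forall k, `|u k| <= M) -> `|cesaro u n| <= M.
Proof.
move=> uM; apply: le_trans (le_normr_cesaro _ _) _.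
apply: le_trans _ (cesaro_cst_le n (le_trans (normr_ge0 _) (uM 0%N))).
exact: le_cesaro.
Qed.

(** Each unit shift exchanges one end term for another, at a cost of at most [2 * M]. *)
Lemma ler_norm_sum_shift u (M : R) (N h : nat) : (forall k, `|u k| <= M) ->
  `|\sum_(k < N) u (k + h)%N - \sum_(k < N) u k| <= 2 * h%:R * M.
Proof.
move=> uM; elim: h => [|h IH].
  rewrite mulr0 mul0r (eq_bigr (fun k : 'I_N => u k)) ?subrr ?normr0// => k _.
  by rewrite addn0.
have -> : \sum_(k < N) u (k + h.+1)%N =
    \sum_(k < N) u (k + h)%N + (u (N + h)%N - u h).
  rewrite -(subrKC (\sum_(k < N) u (k + h)%N) (\sum_(k < N) u (k + h.+1)%N)).
  congr (_ + _); rewrite -sumrB.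
  have := @telescope_sumr R 0%N N (fun k => u (k + h)%N) (leq0n _).
  rewrite big_mkord add0n => <-; apply: eq_bigr => k _.
  by rewrite addnS addSn.
rewrite addrAC (le_trans (ler_normD _ _))// -(natr1 h) mulrDr mulrDl lerD//.
by rewrite mulr1 mulrDl mul1r (le_trans (ler_normB _ _))// lerD.
Qed.

(** Termwise from the square of [|u k| - t] being nonnegative. This stands in for Cauchy-Schwarz
    without a square root; the caller tunes [t]. *)
Lemma ler_norm_sum_sqr u (t : R) (N : nat) : 0 < t ->
  `|\sum_(k < N) u k| <= (2 * t)^-1 * \sum_(k < N) u k ^+ 2 + N%:R * t / 2.
Proof.
move=> t0; apply: le_trans (ler_norm_sum _ _ _) _.
have -> : N%:R * t / 2 = \sum_(k < N) (t / 2).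
  by rewrite sumr_const card_ord -(mulr_natl (t / 2)) mulrA.
rewrite mulr_sumr -big_split/=.
apply: ler_sum => k _.
rewrite -subr_ge0 -[u k ^+ 2]real_normK ?num_real//.
have -> : (2 * t)^-1 * `|u k| ^+ 2 + t / 2 - `|u k| =
          (2 * t)^-1 * (`|u k| - t) ^+ 2 by field; lra.
by rewrite mulr_ge0 ?sqr_ge0// invr_ge0; lra.
Qed.

Lemma telescope_le2 (f u : nat -> R) (s : R) n :
  (forall h, s * u h = f h.+1 - f h) -> (forall h, `|f h| <= 1) ->
  s != 0 -> `|\sum_(h < n) u h| <= 2 / `|s|.
Proof.
move=> fu f1 s0; rewrite ler_pdivlMr ?normr_gt0// mulrC -normrM mulr_sumr.
under eq_bigr do rewrite fu.
rewrite -(big_mkord xpredT (fun h => f h.+1 - f h)) telescope_sumr//.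
by rewrite (le_trans (ler_normB _ _))// -[2]/(1 + 1) lerD.
Qed.

Lemma norm_cos_le1 (a : R) : `|cos a| <= 1.
Proof. by rewrite ler_norml cos_geN1 cos_le1. Qed.

Lemma norm_sin_le1 (a : R) : `|sin a| <= 1.
Proof. by rewrite ler_norml sin_geN1 sin_le1. Qed.

(** Dirichlet kernel: multiplied by [2 * sin (a / 2)] the sum telescopes, so the bound does not
    depend on [n]. *)
Lemma ler_norm_sum_cos (a : R) n : sin (a / 2) != 0 ->
  `|\sum_(h < n) cos (h%:R * a)| <= `|sin (a / 2)|^-1.
Proof.
move=> s0; have -> : `|sin (a / 2)|^-1 = 2 / `|2 * sin (a / 2)|.
  by rewrite normrM normr_nat; field; rewrite normr_eq0.
apply: (telescope_le2 (u := fun h => cos (h%:R * a))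
  (f := fun h => sin (h%:R * a - a / 2))) => [h|h|].
- have -> : h.+1%:R * a - a / 2 = h%:R * a + a / 2 by rewrite -(natr1 h); field.
  by rewrite sinD sinB; ring.
- exact: norm_sin_le1.
- by rewrite mulf_neq0.
Qed.

Lemma ler_norm_sum_sin (a : R) n : sin (a / 2) != 0 ->
  `|\sum_(h < n) sin (h%:R * a)| <= `|sin (a / 2)|^-1.
Proof.
move=> s0; have -> : `|sin (a / 2)|^-1 = 2 / `|2 * sin (a / 2)|.
  by rewrite normrM normr_nat; field; rewrite normr_eq0.
apply: (telescope_le2 (u := fun h => sin (h%:R * a))
  (f := fun h => - cos (h%:R * a - a / 2))) => [h|h|].
- have -> : h.+1%:R * a - a / 2 = h%:R * a + a / 2 by rewrite -(natr1 h); field.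
  by rewrite cosD cosB; ring.
- by rewrite normrN norm_cos_le1.
- by rewrite mulf_neq0.
Qed.

End real_sequences.

(** * Local Fourier energy of a bounded sequence *)

(* The squared modulus of the Fourier coefficient at [theta] of the window
   [x k, ..., x (k + H - 1)].  Its mean over [k] is [mean_energy] of the
   autocorrelations [c] of [x], which tends to the mass at [theta] of the
   spectral measure of [x] as [H] grows. *)
Definition local_energy (R : realType) (x : nat -> R) (H : nat) (theta : R)
    (k : nat) : R :=
  H%:R^-1 ^+ 2 * \sum_(h < H) \sum_(h' < H)
    x (k + h)%N * x (k + h')%N * cos ((h%:R - h'%:R) * theta).

Definition mean_energy (R : realType) (c : nat -> nat -> R) (H : nat)
    (theta : R) : R :=
  H%:R^-1 ^+ 2 * \sum_(h < H) \sum_(h' < H) c h h' * cos ((h%:R - h'%:R) * theta).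

Section energy.
Context {R : realType}.
Implicit Types (x : nat -> R).

(** The energy depends only on differences of phases, so [phi] is free: van der Corput takes the
    phase reached at time [k], Bessel takes 0. *)
Lemma local_energyE x H theta phi k :
  local_energy x H theta k =
    (H%:R^-1 * \sum_(h < H) x (k + h)%N * cos (h%:R * theta + phi)) ^+ 2 +
    (H%:R^-1 * \sum_(h < H) x (k + h)%N * sin (h%:R * theta + phi)) ^+ 2.
Proof.
rewrite /local_energy !exprMn -mulrDr; congr (_ * _).
rewrite !expr2 !big_distrlr/= -big_split/=; apply: eq_bigr => h _.
rewrite -big_split/=; apply: eq_bigr => h' _.
have -> : (h%:R - h'%:R) * theta = (h%:R * theta + phi) - (h'%:R * theta + phi).
  by ring.
by rewrite cosB; ring.
Qed.

Lemma cvg_local_energy x (c : nat -> nat -> R) H theta :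
  (forall h h', cesaro (fun k => x (k + h)%N * x (k + h')%N) @ \oo --> c h h') ->
  cesaro (local_energy x H theta) @ \oo --> mean_energy c H theta.
Proof.
move=> xc; rewrite /mean_energy.
pose F h h' k := cos ((h%:R - h'%:R) * theta) * (x (k + h)%N * x (k + h')%N).
have -> : cesaro (local_energy x H theta) = fun n => H%:R^-1 ^+ 2 *
    \sum_(h < H) \sum_(h' < H) cesaro (F h h') n.
  apply/funext => n; rewrite /local_energy cesaroZl; congr (_ * _).
  rewrite (cesaro_sum _ (fun (h : 'I_H) k => \sum_(h' < H)
    x (k + h)%N * x (k + h')%N * cos ((h%:R - h'%:R) * theta))).
  apply: eq_bigr => h _; rewrite -(cesaro_sum _ (fun h' : 'I_H => F h h')).
  rewrite /cesaro; congr (_ * _); apply: eq_bigr => k _; apply: eq_bigr => h' _.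
  by rewrite /F mulrC.
apply: cvgMr.
apply: (cvg_sum (F := fun (h : 'I_H) n => \sum_(h' < H) cesaro (F h h') n)
  (l := fun h : 'I_H => \sum_(h' < H) c h h' * cos ((h%:R - h'%:R) * theta))) => h.
apply: (cvg_sum (F := fun h' : 'I_H => cesaro (F h h'))
  (l := fun h' : 'I_H => c h h' * cos ((h%:R - h'%:R) * theta))) => h'.
rewrite mulrC (_ : cesaro _ = fun n => cos ((h%:R - h'%:R) * theta) *
    cesaro (fun k => x (k + h)%N * x (k + h')%N) n); last first.
  by apply/funext => n; rewrite cesaroZl.
exact: cvgMr.
Qed.

(* van der Corput: replacing each term by its mean over a window of length [H]
   changes the sum by [O(H)]; the windowed terms are controlled in mean square. *)
Lemma cvg_cesaro_twist0 x (M : R) (c : nat -> nat -> R) theta alpha :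
  (forall k, `|x k| <= M) ->
  (forall h h', cesaro (fun k => x (k + h)%N * x (k + h')%N) @ \oo --> c h h') ->
  (forall e : R, 0 < e -> exists2 H : nat, (0 < H)%N & mean_energy c H theta < e) ->
  cesaro (fun k => x k * cos (k%:R * theta + alpha)) @ \oo --> (0 : R).
Proof.
move=> xM xc small; apply/cvgrPdist_le => e e0.
have M0 : 0 <= M by apply: le_trans (normr_ge0 _) (xM 0%N).
have e4 : 0 < e / 2 by lra.
have [H H0 He] := small ((e / 2) ^+ 2) ltac:(by rewrite exprn_gt0).
have := cvg_local_energy (H := H) (theta := theta) xc.
move=> /cvgr_lt /(_ _ He) [N1 _ hN1].
pose y k := x k * cos (k%:R * theta + alpha).
have yM k : `|y k| <= M.
  rewrite /y normrM -[M]mulr1 ler_pM//; exact: norm_cos_le1.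
pose z k := H%:R^-1 * \sum_(h < H) y (k + h)%N.
(* [z k] is the cosine coefficient of the window, with the phase reached at time [k]; the sine
   square is dropped. *)
have zle k : z k ^+ 2 <= local_energy x H theta k.
  rewrite (local_energyE _ _ _ (k%:R * theta + alpha)) /z /y.
  under eq_bigr do rewrite natrD mulrDl (addrC (k%:R * theta)) -addrA.
  by rewrite lerDl sqr_ge0.
have HR : 0 < H%:R :> R by rewrite ltr0n.
(* Averaging the shifts of the whole sum by [h < H] costs an amount independent of [N]. *)
have yz N : `|\sum_(k < N) y k - \sum_(k < N) z k| <= 2 * H%:R * M.
  have -> : \sum_(k < N) y k - \sum_(k < N) z k =
     H%:R^-1 * \sum_(h < H) (\sum_(k < N) y k - \sum_(k < N) y (k + h)%N).
    rewrite sumrB sumr_const card_ord -(mulr_natl (\sum_(k < N) y k)) mulrBr.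
    rewrite mulKf ?gt_eqF//; congr (_ - _).
    by rewrite exchange_big/= mulr_sumr.
  rewrite normrM ger0_norm ?invr_ge0// ler_pdivrMl//.
  apply: le_trans (ler_norm_sum _ _ _) _.
  have -> : H%:R * (2 * H%:R * M) = \sum_(h < H) (2 * H%:R * M).
    by rewrite sumr_const card_ord -[RHS]mulr_natl.
  apply: ler_sum => h _; rewrite distrC.
  apply: le_trans (ler_norm_sum_shift N h yM) _.
  by rewrite ler_wpM2r// ler_wpM2l// ler_nat ltnW.
have [N2 hN2] : exists N2 : nat, forall n, (N2 <= n)%N -> 2 * H%:R * M <= e / 2 * n%:R.
  exists (Num.trunc (2 * H%:R * M / (e / 2))).+1 => n hn.
  have : 2 * H%:R * M / (e / 2) < n%:R.
    apply: lt_le_trans (truncnS_gt _) _.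
    by rewrite ler_nat.
  by rewrite ltr_pdivrMr// [_ * (e / 2)]mulrC => /ltW.
exists (maxn (maxn N1 N2) 1) => // n /=; rewrite !geq_max -andbA => /and3P[n1 n2 n3].
have nR : 0 < n%:R :> R by rewrite ltr0n.
rewrite sub0r normrN /cesaro -/(y _) normrM ger0_norm ?invr_ge0// ler_pdivrMl//.
have zs : \sum_(k < n) z k ^+ 2 <= n%:R * (e / 2) ^+ 2.
  have := hN1 n n1; rewrite /= /cesaro mulrC ltr_pdivrMr// => /ltW le1.
  rewrite mulrC; apply: le_trans le1; exact: ler_sum.
(* With [t = e / 2] both terms are at most [n * e / 4]; the shift error adds at most [n * e / 2]. *)
have hz := ler_norm_sum_sqr z n e4.
have hz2 : (2 * (e / 2))^-1 * \sum_(k < n) z k ^+ 2 <= n%:R * e / 4.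
  have -> : (2 * (e / 2))^-1 = e^-1 by congr (_^-1); field.
  rewrite ler_pdivrMl//; apply: le_trans zs _.
  by rewrite le_eqVlt; apply/orP; left; apply/eqP; field.
have := yz n; have := hN2 n n2.
move: hz hz2; rewrite -/(y _).
set a := \sum_(k < n) y k; set b := \sum_(k < n) z k => hz hz2 h1 h2.
have -> : a = (a - b) + b by rewrite subrK.
apply: le_trans (ler_normD _ _) _.
nra.
Qed.

(** Bessel's inequality for almost orthogonal characters: the squared distance from [v] to the
    combination of characters with its own Fourier coefficients is nonnegative. The off-diagonal
    inner products, bounded through [K], give the error term, which vanishes as [H] grows. *)
Lemma bessel_window (m : nat) (theta : 'I_m -> R) (v : nat -> R) (M K : R) H :
  (0 < H)%N -> (forall h, `|v h| <= M) -> 0 <= K ->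
  (forall i j n, i != j ->
    `|\sum_(h < n) cos (h%:R * (theta i - theta j))| <= K) ->
  (forall i j n, i != j ->
    `|\sum_(h < n) sin (h%:R * (theta i - theta j))| <= K) ->
  \sum_j ((H%:R^-1 * \sum_(h < H) v h * cos (h%:R * theta j)) ^+ 2 +
          (H%:R^-1 * \sum_(h < H) v h * sin (h%:R * theta j)) ^+ 2)
  <= M ^+ 2 + 4 * m%:R ^+ 2 * M ^+ 2 * K / H%:R.
Proof.
move=> H0 vM K0 Kc Ks.
have M0 : 0 <= M by apply: le_trans (normr_ge0 _) (vM 0%N).
have HR : 0 < H%:R :> R by rewrite ltr0n.
pose a j := H%:R^-1 * \sum_(h < H) v h * cos (h%:R * theta j).
pose b j := H%:R^-1 * \sum_(h < H) v h * sin (h%:R * theta j).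
rewrite -/(a _) -/(b _).
have coefM (w : nat -> R) : (forall h, `|w h| <= 1) ->
    `|H%:R^-1 * \sum_(h < H) v h * w h| <= M.
  move=> w1; rewrite -/(cesaro (fun h => v h * w h) H).
  apply: le_normr_cesaro_bounded => k.
  by rewrite normrM -[M]mulr1 ler_pM.
have aM j : `|a j| <= M.
  by apply: (coefM (fun h => cos (h%:R * theta j))) => h; exact: norm_cos_le1.
have bM j : `|b j| <= M.
  by apply: (coefM (fun h => sin (h%:R * theta j))) => h; exact: norm_sin_le1.
(* [P h] and [Q h] are the real and imaginary parts of the combination of characters with
   coefficients [a j - i b j]. *)
pose P (h : nat) := \sum_j (a j * cos (h%:R * theta j) + b j * sin (h%:R * theta j)).
pose Q (h : nat) := \sum_j (a j * sin (h%:R * theta j) - b j * cos (h%:R * theta j)).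
set S := \sum_j _.
have vv : \sum_(h < H) v h ^+ 2 <= H%:R * M ^+ 2.
  have -> : H%:R * M ^+ 2 = \sum_(h < H) M ^+ 2.
    by rewrite sumr_const card_ord -[RHS]mulr_natl.
  apply: ler_sum => h _; rewrite -[v h ^+ 2]real_normK ?num_real//.
  by rewrite lerXn2r ?nnegrE.
have vP : \sum_(h < H) v h * P h = H%:R * S.
  under eq_bigr do rewrite mulr_sumr.
  rewrite exchange_big/= /S mulr_sumr; apply: eq_bigr => j _.
  have -> : H%:R * (a j ^+ 2 + b j ^+ 2) =
      a j * (H%:R * a j) + b j * (H%:R * b j) by ring.
  have -> : H%:R * a j = \sum_(h < H) v h * cos (h%:R * theta j).
    by rewrite mulVKf ?gt_eqF.
  have -> : H%:R * b j = \sum_(h < H) v h * sin (h%:R * theta j).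
    by rewrite mulVKf ?gt_eqF.
  rewrite !mulr_sumr -big_split/=.
  by apply: eq_bigr => h _; ring.
(* [T i j] is the real part of the inner product, over the window, of the terms [i] and [j] of that
   combination. *)
pose T i j := (a i * a j + b i * b j) * \sum_(h < H) cos (h%:R * (theta i - theta j))
   - (a i * b j - b i * a j) * \sum_(h < H) sin (h%:R * (theta i - theta j)).
have PQ : \sum_(h < H) (P h ^+ 2 + Q h ^+ 2) = \sum_i \sum_j T i j.
  have -> : \sum_i \sum_j T i j = \sum_i \sum_j \sum_(h < H)
     ((a i * a j + b i * b j) * cos (h%:R * (theta i - theta j))
     - (a i * b j - b i * a j) * sin (h%:R * (theta i - theta j))).
    apply: eq_bigr => i _; apply: eq_bigr => j _.
    by rewrite /T !mulr_sumr -sumrB.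
  under [RHS]eq_bigr do rewrite exchange_big/=.
  rewrite [RHS]exchange_big/=; apply: eq_bigr => h _.
  rewrite !expr2 /P /Q !big_distrlr/= -big_split/=; apply: eq_bigr => i _.
  rewrite -big_split/=; apply: eq_bigr => j _.
  by rewrite [h%:R * (_ - _)]mulrBr cosB sinB; ring.
(* The error is granted to the diagonal as well, whence the factor [m ^+ 2] in the bound. *)
have Tle i j : T i j <= (if i == j then H%:R * (a i ^+ 2 + b i ^+ 2) else 0)
    + 4 * M ^+ 2 * K.
  have MK : 0 <= 4 * M ^+ 2 * K by rewrite mulr_ge0// mulr_ge0// sqr_ge0.
  have [<-|ij] := eqVneq i j.
    rewrite /T subrr; under eq_bigr do rewrite mulr0 cos0.
    rewrite sumr_const card_ord; set s := \sum_(h < H) _.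
    have -> : (a i * b i - b i * a i) * s = 0 by ring.
    rewrite subr0 -[leLHS]addr0 lerD// le_eqVlt; apply/orP; left; apply/eqP.
    by rewrite mulrC !expr2.
  rewrite add0r; have := Kc _ _ H ij; have := Ks _ _ H ij; rewrite /T.
  set s := \sum_(h < H) _; set t := \sum_(h < H) _ => sK tK.
  have h4 u w : `|u| <= M -> `|w| <= M -> `|u * w| <= M ^+ 2.
    by move=> ? ?; rewrite normrM expr2 ler_pM.
  apply: le_trans (ler_norm _) _.
  apply: le_trans (ler_normB _ _) _; rewrite !normrM.
  have -> : 4 * M ^+ 2 * K = (M ^+ 2 + M ^+ 2) * K + (M ^+ 2 + M ^+ 2) * K by ring.
  apply: lerD; apply: ler_pM => //.
    by apply: le_trans (ler_normD _ _) _; apply: lerD; exact: h4.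
  by apply: le_trans (ler_normB _ _) _; apply: lerD; exact: h4.
have Tsum : \sum_i \sum_j T i j <= H%:R * S + 4 * m%:R ^+ 2 * M ^+ 2 * K.
  have -> : H%:R * S + 4 * m%:R ^+ 2 * M ^+ 2 * K = \sum_i \sum_j
      ((if i == j then H%:R * (a i ^+ 2 + b i ^+ 2) else 0) + 4 * M ^+ 2 * K).
    under [RHS]eq_bigr => i _.
      rewrite big_split/= -big_mkcond/= (big_pred1 i); last first.
        by move=> j /=; rewrite eq_sym.
      rewrite sumr_const card_ord.
      over.
    rewrite big_split/= -mulr_sumr -/S sumr_const card_ord; congr (_ + _).
    by rewrite -mulrnA -(mulr_natr (4 * M ^+ 2 * K)) natrM; ring.
  by apply: ler_sum => i _; apply: ler_sum.
have : 0 <= \sum_(h < H) ((v h - P h) ^+ 2 + Q h ^+ 2).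
  by apply: sumr_ge0 => h _; rewrite addr_ge0 ?sqr_ge0.
have -> : \sum_(h < H) ((v h - P h) ^+ 2 + Q h ^+ 2) =
    \sum_(h < H) v h ^+ 2 - 2 * \sum_(h < H) v h * P h
    + \sum_(h < H) (P h ^+ 2 + Q h ^+ 2).
  rewrite mulr_sumr -sumrB -big_split/=.
  by apply: eq_bigr => h _; ring.
rewrite vP PQ => ineq.
have : H%:R * S <= H%:R * M ^+ 2 + 4 * m%:R ^+ 2 * M ^+ 2 * K by lra.
rewrite -ler_pdivlMl// => /le_trans; apply.
by rewrite mulrDr mulKf ?gt_eqF// lerD2l mulrC.
Qed.


(** Bessel averaged over the starting points bounds the total energy at the chosen frequencies by
    [M ^+ 2] plus an error in [1 / H]. Distinct frequencies closer than 1 differ modulo 2 pi, which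
    keeps the kernel bounds finite. *)
Lemma mean_energy_card x (M e : R) (c : nat -> nat -> R) (m : nat)
    (theta : 'I_m -> R) :
  (forall k, `|x k| <= M) ->
  (forall h h', cesaro (fun k => x (k + h)%N * x (k + h')%N) @ \oo --> c h h') ->
  injective theta -> (forall i j, `|theta i - theta j| < 1) ->
  (forall i (H : nat), (0 < H)%N -> e <= mean_energy c H (theta i)) ->
  m%:R * e <= M ^+ 2.
Proof.
move=> xM xc th_inj th1 the.
pose kap i j := `|sin ((theta i - theta j) / 2)|^-1.
pose K := \sum_i \sum_j kap i j.
have kap_ge0 i j : 0 <= kap i j by rewrite invr_ge0.
have K0 : 0 <= K by apply: sumr_ge0 => i _; apply: sumr_ge0.
have kapK i j : kap i j <= K.
  rewrite /K (bigD1 i)//= (bigD1 j)//= -addrA lerDl addr_ge0//.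
    by apply: sumr_ge0.
  by apply: sumr_ge0 => ? _; apply: sumr_ge0.
have sin_n0 i j : i != j -> sin ((theta i - theta j) / 2) != 0.
  move=> ij.
  have pos (t : R) : 0 < t -> t < 1 -> sin (t / 2) != 0.
    move=> t0 t1; rewrite gt_eqF// sin_gt0_pi//.
    by have := @pi_ge2 R; lra.
  have : theta i - theta j != 0 by rewrite subr_eq0; apply: contra_neq ij => /th_inj.
  have := th1 i j; rewrite ltr_norml => /andP[h1 h2].
  case: (ltrgt0P (theta i - theta j)) => // h _; first exact: pos.
  have -> : (theta i - theta j) / 2 = - ((theta j - theta i) / 2) by lra.
  by rewrite sinN oppr_eq0; apply: pos; lra.
have bound H : (0 < H)%N ->
    m%:R * e <= M ^+ 2 + 4 * m%:R ^+ 2 * M ^+ 2 * K / H%:R.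
  move=> H0.
  apply: (@le_trans _ _ (\sum_(j < m) mean_energy c H (theta j))).
    have -> : m%:R * e = \sum_(j < m) e by rewrite sumr_const card_ord -[RHS]mulr_natl.
    by apply: ler_sum => j _; exact: the.
  have cvS : (fun n => \sum_(j < m) cesaro (local_energy x H (theta j)) n) @ \oo
      --> \sum_(j < m) mean_energy c H (theta j).
    by apply: cvg_sum => j; exact: cvg_local_energy.
  apply: (cvgr_to_le cvS); apply: nearW => n.
  rewrite -(cesaro_sum _ (fun j => local_energy x H (theta j))).
  set B := (leRHS).
  have B0 : 0 <= B.
    by rewrite addr_ge0 ?sqr_ge0// divr_ge0// mulr_ge0// mulr_ge0 ?sqr_ge0// mulr_ge0 ?sqr_ge0.
  apply: le_trans (cesaro_cst_le n B0); apply: le_cesaro => k.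
  have Hb := @bessel_window m theta (fun h => x (k + h)%N) M K H H0 (fun h => xM _) K0.
  under eq_bigr => j _.
    rewrite (local_energyE _ _ _ 0).
    under eq_bigr do rewrite addr0.
    under [X in _ + (_ * X) ^+ 2]eq_bigr do rewrite addr0.
    over.
  apply: Hb => i j p ij.
    by apply: le_trans (kapK i j); exact/ler_norm_sum_cos/sin_n0.
  by apply: le_trans (kapK i j); exact/ler_norm_sum_sin/sin_n0.
rewrite leNgt; apply/negP => lt.
set C := 4 * m%:R ^+ 2 * M ^+ 2 * K in bound.
(* If the bound failed by [d], a window longer than [C / d] would make the error smaller than
   [d]. *)
pose d := m%:R * e - M ^+ 2; have d0 : 0 < d by rewrite /d; lra.
have := bound (Num.trunc (C / d)).+1 isT.
have H0 : 0 < (Num.trunc (C / d)).+1%:R :> R by rewrite ltr0n.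
have := truncnS_gt (C / d); rewrite ltr_pdivrMr// mulrC -ltr_pdivrMr//.
set q := C / _.+1%:R => qd; have : d = m%:R * e - M ^+ 2 by [].
by move: qd; clearbody q d; lra.
Qed.

(** By [mean_energy_card] only finitely many frequencies in []theta - 1, theta[] keep energy at
    least [e] for all windows, so some interval ending at [theta] avoids them. *)
Lemma mean_energy_isolated x (M e : R) (c : nat -> nat -> R) (theta : R) :
  (forall k, `|x k| <= M) ->
  (forall h h', cesaro (fun k => x (k + h)%N * x (k + h')%N) @ \oo --> c h h') ->
  0 < e ->
  exists2 a, a < theta & forall t, a <= t < theta ->
    exists2 H : nat, (0 < H)%N & mean_energy c H t < e.
Proof.
move=> xM xc e0.
pose L := [set t : R | theta - 1 < t < theta /\
   forall H : nat, (0 < H)%N -> e <= mean_energy c H t].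
have finL : finite_set L.
  apply: contrapT => /(infinite_set_fset (Num.trunc (M ^+ 2 / e)).+1) [B BL mB].
  set m := (Num.trunc (M ^+ 2 / e)).+1 in mB.
  pose th (i : 'I_m) := nth 0 (finmap.enum_fset B) i.
  have thL i : L (th i).
    by apply: BL; rewrite /= mem_nth// (leq_trans (ltn_ord i)).
  have : m%:R * e <= M ^+ 2.
    apply: (mean_energy_card (theta := th) xM xc).
    - move=> i j /eqP; rewrite nth_uniq ?finmap.fset_uniq ?(leq_trans (ltn_ord _))//.
      by move=> /eqP ij; exact: val_inj.
    - move=> i j; have [/andP[? ?] _] := thL i; have [/andP[? ?] _] := thL j.
      by rewrite ltr_norml; apply/andP; split; lra.
    - by move=> i; have [] := thL i.
  by rewrite -ler_pdivlMr// leNgt truncnS_gt.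
have /finite_seqP [s Ls] := finL.
(* Move [a] past each element of the list below [theta] in turn, halfway from the larger of the two
   to [theta]. *)
have [a /andP[a1 a2] as_] :
    exists2 a, theta - 1 < a < theta & forall t, t \in s -> t < theta -> t < a.
  elim: s {Ls} => [|t s [a /andP[a1 a2] IH]].
    by exists (theta - 2^-1) => //; apply/andP; split; lra.
  have [tth|tth] := ltP t theta; last first.
    exists a; first by rewrite a1.
    move=> u; rewrite inE => /predU1P[->|]; [lra|exact: IH].
  exists ((Num.max a t + theta) / 2).
    have : a <= Num.max a t by rewrite le_max lexx.
    have : Num.max a t < theta by rewrite gt_max a2.
    by move=> ? ?; apply/andP; split; lra.
  move=> u; rewrite inE => us uth.
  have : u <= Num.max a t.
    rewrite le_max; case/predU1P : us => [->|us]; first by rewrite lexx orbT.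
    by rewrite (ltW (IH _ us uth)).
  have : Num.max a t < theta by rewrite gt_max a2.
  by move=> ? ?; lra.
exists a => // t /andP[at_ tth].
apply: contrapT => no; have Lt : L t.
  split; first by apply/andP; split; lra.
  move=> H H0; rewrite leNgt; apply/negP => lt; apply: no; by exists H.
have : t \in s by move: Lt; rewrite Ls.
by move=> /as_ /(_ tth); lra.
Qed.

End energy.

(** * Ergodic theorems for bounded functions *)

(** Not restricted to probabilities, so that it also applies to [skew_measure]. *)
Definition invariant_measure (R : realType) (d : measure_display)
    (X : measurableType d) (mu : set X -> \bar R) (S : X -> X) : Prop :=
  measurable_fun setT S /\
  forall A : set X, measurable A -> mu (S @^-1` A) = mu A.

Section integral_invariance.
Context {R : realType} d {X : measurableType d}.
Variables (mu : {measure set X -> \bar R}) (S : X -> X).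
Hypothesis Smu : invariant_measure mu S.

Lemma measurable_iter k : measurable_fun setT (iter k S).
Proof.
elim: k => [|k IH] /=; first exact: measurable_id.
exact: (measurableT_comp Smu.1 IH).
Qed.

Lemma ge0_integral_invariant (g : X -> \bar R) :
  measurable_fun setT g -> (forall x, (0 <= g x)%E) ->
  (\int[mu]_x g (S x) = \int[mu]_x g x)%E.
Proof.
move=> mg g0.
have := @ge0_integral_pushforward _ _ _ _ R S Smu.1 mu setT g measurableT mg.
move=> /(_ (fun x _ => g0 x)); rewrite preimage_setT => <-.
by apply: eq_measure_integral => [|mS A mA _]; [exact: Smu.1|exact: Smu.2].
Qed.

Lemma integrable_invariant (g : X -> R) : mu.-integrable setT (EFin \o g) ->
  mu.-integrable setT (EFin \o (g \o S)).
Proof.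
move=> /integrableP [mg gfin]; apply/integrableP; split.
  by rewrite compA; exact: measurableT_comp Smu.1.
rewrite [ltLHS](ge0_integral_invariant (g := fun x => `|(g x)%:E|%E))//.
exact: measurableT_comp.
Qed.

Lemma integral_invariant (g : X -> R) : mu.-integrable setT (EFin \o g) ->
  (\int[mu]_x (g (S x))%:E = \int[mu]_x (g x)%:E)%E.
Proof.
move=> ig; have [mg gfin] := integrableP _ _ _ ig.
have := @integral_pushforward _ _ _ _ R S Smu.1 mu setT (EFin \o g) mg.
rewrite preimage_setT => /(_ (integrable_invariant ig) measurableT) /= <-.
by apply: eq_measure_integral => [|mS A mA _]; [exact: Smu.1|exact: Smu.2].
Qed.

Lemma integrable_mul_indic (g : X -> R) (B : set X) : measurable B ->
  mu.-integrable setT (EFin \o g) ->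
  mu.-integrable setT (fun x => (g x * \1_B x)%:E).
Proof.
move=> mB ig; apply: (le_integrable measurableT _ _ ig).
  apply/measurable_EFinP; apply: measurable_funM; last exact/measurable_indicP.
  by apply/measurable_EFinP; exact: measurable_int ig.
move=> x _; rewrite lee_fin normrM indicE.
by case: (_ \in _); rewrite ?normr1 ?normr0 ?mulr1 ?mulr0.
Qed.

Lemma ae_iter (P : X -> Prop) : {ae mu, forall x, P x} ->
  {ae mu, forall x, forall k, P (iter k S x)}.
Proof.
move=> aeP; apply: ae_foralln; elim=> [//|k [N [mN N0 PN]]].
exists (S @^-1` N); split.
- by rewrite -[X in measurable X]setTI; exact: Smu.1.
- by rewrite Smu.2.
- by move=> x /= nP; apply: PN => /=; rewrite -iterSr.
Qed.

End integral_invariance.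

(** * The maximal ergodic theorem *)

Section maximal_ergodic_theorem.
Context {R : realType} d {X : measurableType d}.
Variables (mu : {measure set X -> \bar R}) (S : X -> X).
Hypothesis Smu : invariant_measure mu S.

(* The maximum of the Birkhoff sums of length at most [N], the empty sum
   included. *)
Fixpoint max_birkhoff (g : X -> R) (N : nat) (x : X) : R :=
  if N is N'.+1 then Num.max 0 (g x + max_birkhoff g N' (S x)) else 0.

Lemma max_birkhoff_ge0 g N x : 0 <= max_birkhoff g N x.
Proof. by case: N => //= N; rewrite le_max lexx. Qed.

Lemma max_birkhoff_nd g N x : max_birkhoff g N x <= max_birkhoff g N.+1 x.
Proof.
elim: N x => [|N IH] x; first exact: max_birkhoff_ge0.
rewrite [leLHS]/= [leRHS]/=.
by rewrite ge_max le_max lexx/= le_max lerD2l IH orbT.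
Qed.

Lemma max_birkhoff_le_sum g N x : 0 < max_birkhoff g N x ->
  exists n, max_birkhoff g N x = \sum_(k < n) g (iter k S x).
Proof.
elim: N x => [|N IH] x; first by rewrite ltxx.
rewrite /=; case: (leP (g x + max_birkhoff g N (S x)) 0); first by rewrite ltxx.
move=> h _; case: (ltrgt0P (max_birkhoff g N (S x))) => h0.
- have [n ->] := IH _ h0; exists n.+1.
  by rewrite big_ord_recl/=; congr (_ + _); apply: eq_bigr => k _; rewrite -iterSr.
- by have := max_birkhoff_ge0 g N (S x); rewrite leNgt h0.
- by exists 1%N; rewrite big_ord_recl big_ord0 /= h0.
Qed.

Lemma sum_le_max_birkhoff g n x : \sum_(k < n) g (iter k S x) <= max_birkhoff g n x.
Proof.
elim: n x => [|n IH] x; first by rewrite big_ord0.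
rewrite big_ord_recl/= le_max lerD2l; apply/orP; right.
by under eq_bigr do rewrite -iterS iterSr; exact: IH.
Qed.

Lemma integrable_max_birkhoff g N : mu.-integrable setT (EFin \o g) ->
  mu.-integrable setT (EFin \o max_birkhoff g N).
Proof.
move=> ig; elim: N => [|N IH]; first exact: integrable0.
have imax := integrable_invariant Smu IH.
apply: (le_integrable measurableT _ _ (integrableD measurableT ig imax)).
  apply/measurable_EFinP; apply: measurable_maxr => //.
  by apply: measurable_funD; apply/measurable_EFinP/measurable_int; eauto.
move=> x _ /=; rewrite lee_fin (ger0_norm (max_birkhoff_ge0 g N.+1 x)) /=.
by rewrite ge_max normr_ge0 ler_norm.
Qed.

(** Garsia's argument: where [max_birkhoff g N] is positive, it is at most [g] plus its own value
    after one step; elsewhere it is 0. Integrating, invariance cancels the two maxima. Then [N]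
    tends to infinity by dominated convergence. *)
Theorem maximal_ergodic (g : X -> R) : mu.-integrable setT (EFin \o g) ->
  0 <= \int[mu]_x (g x * \1_[set x | exists n, 0 < \sum_(k < n) g (iter k S x)] x).
Proof.
move=> ig.
have mgx : measurable_fun setT g by apply/measurable_EFinP; exact: measurable_int ig.
pose B N := [set x | 0 < max_birkhoff g N x].
have mM N : measurable_fun setT (max_birkhoff g N).
  by apply/measurable_EFinP; exact: measurable_int (integrable_max_birkhoff N ig).
have mB N : measurable (B N).
  rewrite -[B N]setTI; have := mM N measurableT _ (measurable_itv `]0, +oo[).
  by congr (measurable (_ `&` _)); apply/seteqP; split => x /=; rewrite in_itv/= andbT.
have gB N : (0 <= \int[mu]_x (g x * \1_(B N) x)%:E)%E.
  have iM := integrable_max_birkhoff N ig.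
  have iMS := integrable_invariant Smu iM.
  have : (\int[mu]_x (max_birkhoff g N x - max_birkhoff g N (S x))%:E = 0)%E.
    rewrite integralB_EFin// (integral_invariant Smu iM) subee//.
    exact: integrable_fin_num.
  move=> <-; apply: le_integral => //.
  - by apply: eq_integrable (integrableB measurableT iM iMS).
  - exact: integrable_mul_indic.
  move=> x _; rewrite lee_fin indicE.
  case: (boolP (x \in B N)); rewrite ?inE ?notin_setE /B /=.
    case: N {iM iMS} => [|N]; first by rewrite ltxx.
    rewrite mulr1 => h.
    have -> : max_birkhoff g N.+1 x = g x + max_birkhoff g N (S x).
      by move: h; rewrite /= lt_max ltxx => /= h; exact/max_idPr/ltW.
    by have := max_birkhoff_nd g N (S x); lra.
  move=> /negP; rewrite -leNgt mulr0 => h.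
  by have := max_birkhoff_ge0 g N (S x); lra.
set E := [set x | _].
have EB : E = \bigcup_N B N.
  apply/seteqP; split=> [x [n gn]|x [N _ BN]].
    by exists n => //; apply: lt_le_trans gn (sum_le_max_birkhoff _ _ _).
  by have [n hn] := max_birkhoff_le_sum BN; exists n; rewrite -hn.
rewrite /Rintegral fine_ge0//.
have cvB : (\int[mu]_x (g x * \1_(B N) x)%:E)%E @[N --> \oo] -->
    (\int[mu]_x (g x * \1_E x)%:E)%E.
  apply: (@dominated_cvg _ _ _ mu setT measurableT _ _ (fun x => `|(g x)%:E|%E)).
  - move=> N; apply/measurable_EFinP; apply: measurable_funM => //.
  (* The sets [B N] increase to [E], so at each point the indicator is eventually constant. *)
  - move=> x _; apply: cvg_near_cst.
    have BE N : B N x -> E x by rewrite EB; exists N.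
    have [Ex|nE] := pselect (E x); last first.
      by apply: nearW => N; rewrite !indicE !memNset//; apply: contra_not nE => /BE.
    move: (Ex); rewrite {1}EB => -[N _ BN].
    exists N => // n /= Nn.
    rewrite !indicE !mem_set//.
    apply: lt_le_trans BN _; rewrite -(subnK Nn).
    elim: (n - N)%N => [|m IH]; first by rewrite add0n.
    by rewrite addSn; exact: le_trans IH (max_birkhoff_nd _ _ _).
  - by [].
  - exact: integrable_abse.
  - move=> N x _; rewrite lee_fin normrM indicE.
    by case: (_ \in _); rewrite ?normr1 ?normr0 ?mulr1 ?mulr0.
rewrite -(cvg_lim _ cvB)//; apply: lime_ge; last exact: nearW.
by apply/cvg_ex; eexists; exact: cvB.
Qed.

End maximal_ergodic_theorem.

Lemma measurable_set_ltr (R : realType) d (X : measurableType d) (g h : X -> R) :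
  measurable_fun setT g -> measurable_fun setT h ->
  measurable [set x | g x < h x].
Proof.
move=> mg mh; have := measurable_fun_ltr mg mh measurableT (_ : measurable [set true]).
by rewrite setTI; apply.
Qed.

Lemma integrable_bounded (R : realType) d (X : measurableType d)
    (mu : {finite_measure set X -> \bar R}) (g : X -> R) (M : R) :
  measurable_fun setT g -> (forall x, `|g x| <= M) ->
  mu.-integrable setT (EFin \o g).
Proof.
move=> mg gM; apply: measurable_bounded_integrable => //.
  by rewrite -ge0_fin_numE// fin_num_measure.
exists M; split; first exact: num_real.
by move=> y My x _ /=; apply: le_trans (gM x) _; exact: ltW.
Qed.

(** * Birkhoff's theorem for bounded functions *)

Section birkhoff.
Context {R : realType} d {X : measurableType d}.
Variables (mu : {finite_measure set X -> \bar R}) (S : X -> X).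
Hypothesis Smu : invariant_measure mu S.

Lemma measurable_birkhoff_sum (g : X -> R) n : measurable_fun setT g ->
  measurable_fun setT (fun x => \sum_(k < n) g (iter k S x)).
Proof.
move=> mg; apply: measurable_sum => k.
exact: (measurableT_comp mg (measurable_iter Smu k)).
Qed.

Lemma measurable_cesaro (g : X -> R) n : measurable_fun setT g ->
  measurable_fun setT (fun x => cesaro (fun k => g (iter k S x)) n).
Proof.
by move=> mg; apply: measurable_funM => //; exact: measurable_birkhoff_sum.
Qed.

Lemma Rintegral_mul_indic (a : R) (B : set X) : measurable B ->
  \int[mu]_x (a * \1_B x) = a * fine (mu B).
Proof.
move=> mB; rewrite RintegralZl//; last exact: integrable_indic.
by rewrite /Rintegral integral_indic// setIT.
Qed.

(** This is [maximal_ergodic] for [g - lambda], whose Birkhoff sums are positive exactly where an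
    average exceeds [lambda]. The empty average is 0 and never counts, as [lambda] is positive. *)
Lemma weak_maximal_inequality (g : X -> R) (lambda : R) :
  mu.-integrable setT (EFin \o g) -> (forall x, 0 <= g x) -> 0 < lambda ->
  lambda * fine (mu [set x | exists n,
    lambda < cesaro (fun k => g (iter k S x)) n]) <= \int[mu]_x g x.
Proof.
move=> ig g0 l0.
have mg : measurable_fun setT g by apply/measurable_EFinP; exact: measurable_int ig.
set B := [set x | _].
have il : mu.-integrable setT (EFin \o fun=> lambda).
  by apply: (@integrable_bounded _ _ _ _ _ `|lambda|).
have := maximal_ergodic Smu (g := fun x => g x - lambda)
  (integrableB measurableT ig il).
set B' := [set x | _].
have BB : B' = B.
  apply/seteqP; split => x [n]; rewrite /cesaro.
    rewrite sumrB sumr_const card_ord; case: n => [|n]; first by rewrite big_ord0 subrr ltxx.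
    rewrite subr_gt0 => h; exists n.+1.
    by rewrite /cesaro mulrC ltr_pdivlMr ?ltr0n// mulr_natr.
  move=> h; exists n; move: h; case: n => [|n].
    by rewrite big_ord0 mulr0 ltNge ltW.
  rewrite mulrC ltr_pdivlMr ?ltr0n// mulr_natr => h.
  by rewrite sumrB sumr_const card_ord subr_gt0.
have mB : measurable B.
  rewrite (_ : B = \bigcup_n [set x | lambda < cesaro (fun k => g (iter k S x)) n]).
    apply: bigcupT_measurable => n; apply: measurable_set_ltr => //.
    exact: measurable_cesaro.
  by apply/seteqP; split=> [x [n h]|x [n _ h]]; exists n.
rewrite BB (_ : (fun x => _) = fun x => g x * \1_B x - lambda * \1_B x); last first.
  by apply/funext => x; rewrite mulrBl.
rewrite RintegralB//; last 2 first.
- exact: integrable_mul_indic.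
- exact: integrable_mul_indic.
rewrite Rintegral_mul_indic// subr_ge0 => /le_trans; apply.
apply: le_Rintegral => //; first exact: integrable_mul_indic.
by move=> x _; rewrite indicE; case: (_ \in _); rewrite ?mulr1 ?mulr0.
Qed.

Section bounded.
Variables (f : X -> R) (M : R).
Hypotheses (mf : measurable_fun setT f) (fM : forall x, `|f x| <= M).

Let avg x := cesaro (fun k => f (iter k S x)).

(* The margin [m.+1%:R^-1] makes the set exactly invariant: the averages
   along [x] and [S x] have asymptotically the same values, not the same. *)
Definition gap_set (a b : R) : set X := \bigcup_m
  ([set x | forall N, exists2 n, (N <= n)%N & avg x n < a - m.+1%:R^-1] `&`
   [set x | forall N, exists2 n, (N <= n)%N & b + m.+1%:R^-1 < avg x n]).

Lemma measurable_gap_set a b : measurable (gap_set a b).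
Proof.
apply: bigcupT_measurable => m; apply: measurableI.
  rewrite (_ : mkset _ = \bigcap_N \bigcup_(n in [set n | (N <= n)%N])
      [set x | avg x n < a - m.+1%:R^-1]); last first.
    apply/seteqP; split=> [x h N _|x h N]; first by have [n] := h N; exists n.
    by have [n] := h N I; exists n.
  apply: bigcapT_measurable => N; apply: bigcup_measurable => n _.
  by apply: measurable_set_ltr => //; exact: measurable_cesaro.
rewrite (_ : mkset _ = \bigcap_N \bigcup_(n in [set n | (N <= n)%N])
    [set x | b + m.+1%:R^-1 < avg x n]); last first.
  apply/seteqP; split=> [x h N _|x h N]; first by have [n] := h N; exists n.
  by have [n] := h N I; exists n.
apply: bigcapT_measurable => N; apply: bigcup_measurable => n _.
by apply: measurable_set_ltr => //; exact: measurable_cesaro.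
Qed.

Lemma avg_shift x (e : R) : 0 < e ->
  exists N, forall n, (N <= n)%N -> `|avg (S x) n - avg x n| <= e.
Proof.
move=> e0; exists (Num.trunc (2 * M / e)).+1 => n hn.
have n0 : (0 < n)%N by apply: leq_trans hn.
have nR : 0 < n%:R :> R by rewrite ltr0n.
rewrite /avg /cesaro -mulrBr normrM ger0_norm ?invr_ge0// ler_pdivrMl//.
have := ler_norm_sum_shift (u := fun k => f (iter k S x)) n 1 (fun k => fM _).
rewrite mulr1.
under eq_bigr do rewrite addn1 iterSr.
move=> /le_trans; apply; rewrite -ler_pdivrMr//; apply/ltW.
by apply: lt_le_trans (truncnS_gt _) _; rewrite ler_nat.
Qed.

(** The averages from [x] and [S x] eventually differ by at most half the margin, so it suffices to
    halve the margin, which is the one at index [(2 * m.+1).-1]. *)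
Lemma gap_set_invariant a b x : gap_set a b (S x) <-> gap_set a b x.
Proof.
have half (m : nat) : ((2 * m.+1).-1.+1)%:R^-1 = m.+1%:R^-1 / 2 :> R.
  by rewrite prednK ?muln_gt0// natrM invfM mulrC.
have pos (m : nat) : 0 < m.+1%:R^-1 / 2 :> R by rewrite divr_gt0 ?invr_gt0 ?ltr0n.
split=> -[m _ [h1 h2]]; have [N0 hN] := avg_shift x (pos m);
  exists (2 * m.+1).-1 => //; split=> N; rewrite half;
  set r := m.+1%:R^-1 in h1 h2 hN *; clearbody r.
- have [n] := h1 (maxn N0 N); rewrite geq_max => /andP[/hN + Nn] ?.
  by rewrite ler_distl => /andP[? ?]; exists n => //; lra.
- have [n] := h2 (maxn N0 N); rewrite geq_max => /andP[/hN + Nn] ?.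
  by rewrite ler_distl => /andP[? ?]; exists n => //; lra.
- have [n] := h1 (maxn N0 N); rewrite geq_max => /andP[/hN + Nn] ?.
  by rewrite ler_distl => /andP[? ?]; exists n => //; lra.
- have [n] := h2 (maxn N0 N); rewrite geq_max => /andP[/hN + Nn] ?.
  by rewrite ler_distl => /andP[? ?]; exists n => //; lra.
Qed.

Lemma gap_set_iter a b x k : (iter k S x \in gap_set a b) = (x \in gap_set a b).
Proof.
elim: k => //= k <-; apply/idP/idP; rewrite !inE.
  by move=> /gap_set_invariant.
by move=> /gap_set_invariant.
Qed.

(** By invariance the sums of [h] cut to [E], from a point of [E], are those of [h], so the
    positivity set in [maximal_ergodic] contains [E]; off [E] the integrand is 0 anyway. *)
Lemma maximal_ergodic_invariant (h : X -> R) (E : set X) (K : R) :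
  measurable E -> measurable_fun setT h -> (forall x, `|h x| <= K) ->
  (forall x k, (iter k S x \in E) = (x \in E)) ->
  (forall x, E x -> exists n, 0 < \sum_(k < n) h (iter k S x)) ->
  0 <= \int[mu]_x (h x * \1_E x).
Proof.
move=> mE mh hK invE hE.
have ig : mu.-integrable setT (EFin \o (fun x => h x * \1_E x)).
  by apply: integrable_mul_indic => //; exact: (@integrable_bounded _ _ _ _ _ K).
have := maximal_ergodic Smu ig; congr (0 <= _).
apply: eq_Rintegral => x _; rewrite [in LHS]indicE [in RHS]indicE indicE.
have [xE|xE] := boolP (x \in E); last by rewrite !mulr0 mul0r.
have [n hn] := hE _ (set_mem xE).
rewrite [X in _ * X](_ : _ = 1) ?mulr1//; apply/eqP; rewrite pnatr_eq1 eqb1.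
rewrite mem_set//; exists n; move: hn.
rewrite (eq_bigr (fun k : 'I_n => h (iter k S x) * \1_E (iter k S x)))// => k _.
by rewrite indicE invE xE mulr1.
Qed.

(** On this invariant set some average exceeds [b] and some average is below [a]. The maximal
    theorem for [f - b] and for [a - f] adds up to [0 <= (a - b) * mu E]. *)
Lemma mu_gap_set a b : a < b -> mu (gap_set a b) = 0%E.
Proof.
move=> ab; have mE := measurable_gap_set a b; set E := gap_set a b in mE *.
have iE x k : (iter k S x \in E) = (x \in E) by exact: gap_set_iter.
have mfin : mu E \is a fin_num by exact: fin_num_measure.
have avg0 x n : avg x n * n%:R = \sum_(k < n) f (iter k S x).
  case: n => [|n]; first by rewrite mulr0 big_ord0.
  by rewrite /avg /cesaro mulrC mulVKf// pnatr_eq0.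
have h1 : 0 <= \int[mu]_x ((f x - b) * \1_E x).
  apply: (@maximal_ergodic_invariant _ _ (M + `|b|)) => //.
  - exact: measurable_funB.
  - by move=> x; apply: le_trans (ler_normB _ _) _; rewrite lerD2r.
  (* Asking for [n >= 1] excludes the empty average, which carries no information on [f]. *)
  - move=> x [m _ [_ /(_ 1%N) [n n1 bn]]]; exists n.
    rewrite sumrB sumr_const card_ord -avg0 -(mulr_natr b) -mulrBl.
    rewrite mulr_gt0 ?ltr0n// subr_gt0; apply: le_lt_trans bn.
    by rewrite lerDl invr_ge0.
have h2 : 0 <= \int[mu]_x ((a - f x) * \1_E x).
  apply: (@maximal_ergodic_invariant _ _ (`|a| + M)) => //.
  - exact: measurable_funB.
  - by move=> x; apply: le_trans (ler_normB _ _) _; rewrite lerD2l.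
  - move=> x [m _ [/(_ 1%N) [n n1 bn] _]]; exists n.
    rewrite sumrB sumr_const card_ord -avg0 -(mulr_natr a) -mulrBl.
    rewrite mulr_gt0 ?ltr0n// subr_gt0; apply: lt_le_trans bn _.
    by rewrite gerBl invr_ge0.
have i1 : mu.-integrable setT (EFin \o (fun x => (f x - b) * \1_E x)).
  apply: integrable_mul_indic => //.
  apply: (@integrable_bounded _ _ _ _ _ (M + `|b|)); first exact: measurable_funB.
  by move=> x; apply: le_trans (ler_normB _ _) _; rewrite lerD2r.
have i2 : mu.-integrable setT (EFin \o (fun x => (a - f x) * \1_E x)).
  apply: integrable_mul_indic => //.
  apply: (@integrable_bounded _ _ _ _ _ (`|a| + M)); first exact: measurable_funB.
  by move=> x; apply: le_trans (ler_normB _ _) _; rewrite lerD2l.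
have := addr_ge0 h1 h2; rewrite -RintegralD//.
rewrite (_ : (fun x => _) = fun x => (a - b) * \1_E x); last first.
  by apply/funext => x; ring.
rewrite Rintegral_mul_indic// nmulr_rge0 ?subr_lt0// => hle.
have : 0 <= fine (mu E) by exact: fine_ge0.
by rewrite le_eqVlt ltNge hle orbF => /eqP h; rewrite -(fineK mfin) -h.
Qed.

Theorem birkhoff_bounded : exists2 fb : X -> R, measurable_fun setT fb &
  {ae mu, forall x, cesaro (fun k => f (iter k S x)) @ \oo --> fb x}.
Proof.
(* The upper limit is measurable everywhere and equals the limit wherever there is one. *)
exists (fun x => fine (limn_esup (fun n => (avg x n)%:E))).
  apply: measurableT_comp; first exact: fine_measurable.
  apply: (measurable_fun_limn_esup (f := fun n x => (avg x n)%:E)) => n.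
  by apply/measurable_EFinP; exact: measurable_cesaro.
have aeN : {ae mu, forall x, forall a b : rat, a < b -> ~ gap_set (ratr a) (ratr b) x}.
  have : {ae mu, forall x, forall n : nat, forall ab : rat * rat, unpickle n = Some ab ->
       ab.1 < ab.2 -> ~ gap_set (ratr ab.1) (ratr ab.2) x}.
    apply: ae_foralln => n; case: (unpickle n) => [[a b]|]; last exact: aeW.
    have [ab|ba] := ltP a b; last by apply: aeW => x ? [<-] /=; rewrite ltNge ba.
    exists (gap_set (ratr a) (ratr b)); split.
    - exact: measurable_gap_set.
    - by apply: mu_gap_set; rewrite ltr_rat.
    - by move=> x /= h; apply: contrapT => nE; apply: h => _ [<-].
  apply: filterS => x h a b ab; exact: (h (pickle (a, b)) (a, b) (pickleK _) ab).
apply: filterS aeN => x nogap.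
have cv : cvgn (avg x).
  apply: (is_cvg_no_rat_gap (M := M)).
    by move=> n; apply: le_normr_cesaro_bounded => k; exact: fM.
  move=> a b ab [io1 io2].
  (* Shrinking the gap by a third at each end leaves room for the margin in [gap_set]. *)
  have ab3 : 0 < (b - a) / 3%:R by rewrite divr_gt0// subr_gt0.
  have ab' : a + (b - a) / 3%:R < b - (b - a) / 3%:R.
    rewrite ltrBrDr -addrA -ltrBrDl -mulrDl ltr_pdivrMr//.
    by rewrite -subr_gt0 mulr_natr !mulrS mulr0n; lra.
  apply: (nogap _ _ ab').
  have e0 : 0 < ratr ((b - a) / 3%:R) :> R by rewrite ltr0q.
  exists (Num.trunc ((ratr ((b - a) / 3%:R))^-1 : R)) => //.
  set m := Num.trunc _.
  have le : m.+1%:R^-1 <= ratr ((b - a) / 3%:R) :> R.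
    by rewrite invf_ple ?posrE// ltW// truncnS_gt.
  rewrite rmorphD/= rmorphB/=; split=> N;
    set q := m.+1%:R^-1 in le *; clearbody q.
    by have [n Nn hn] := io1 N; exists n => //; lra.
  by have [n Nn hn] := io2 N; exists n => //; lra.
move/cvg_ex : cv => [l cl].
have cE : (fun n => (avg x n)%:E) @ \oo --> l%:E by exact: cvg_EFin (nearW _ _) cl.
have -> : limn_esup (fun n => (avg x n)%:E) = l%:E.
  rewrite is_cvg_limn_esupE; first exact: cvg_lim.
  by apply/cvg_ex; exists l%:E.
exact: cl.
Qed.

End bounded.
End birkhoff.

(** * Skew products with the circle *)

Section circle.
Context {R : realType}.
Local Notation leb := (@lebesgue_measure R).

Lemma measurable_addr_cst (c : R) :
  measurable_fun setT (fun x : measurableTypeR R => x + c : measurableTypeR R).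
Proof. exact: measurable_funD. Qed.

Lemma lebesgue_measure_translation (c : R) (A : set R) : measurable A ->
  leb ((fun x => x + c) @^-1` A) = leb A.
Proof.
move=> mA.
have mc : measurable_fun setT (fun x : measurableTypeR R => x + c : measurableTypeR R).
  exact: measurable_addr_cst.
have := @lebesgue_measure_unique R
  (pushforward leb (fun x : measurableTypeR R => x + c : measurableTypeR R)).
move=> /(_ mc) H; apply/esym/H => //= _ [[a b]] _ <-.
rewrite /pushforward.
rewrite (_ : _ @^-1` _ = `]a - c, b - c]%classic); last first.
  by apply/seteqP; split=> x /=; rewrite !in_itv/= ltrBlDr lerBrDr.
by rewrite !lebesgue_measure_itv/= !lte_fin ltrD2r -!EFinB;
  congr (if _ then _%:E else _); ring.
Qed.

Definition frac (x : R) : R := x - (Num.floor x)%:~R.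

Lemma measurable_frac : measurable_fun setT frac.
Proof.
apply: measurable_funB => // _ Y mY; rewrite setTI.
rewrite (_ : _ @^-1` Y = \bigcup_(k : int)
    (`[k%:~R, (k + 1)%:~R[%classic `&` [set _ | Y k%:~R])); last first.
  apply/seteqP; split=> [x /= Yx|x [k _ []]] /=.
    by exists (Num.floor x) => //; split=> //=; rewrite in_itv/= floor_itv.
  by rewrite in_itv/= => /floor_def ->.
apply: countable_bigcupT_measurable => [|k]; first exact: countableP.
have [Yk|nYk] := pselect (Y k%:~R).
  rewrite (_ : _ `&` _ = `[k%:~R, (k + 1)%:~R[%classic); first exact: measurable_itv.
  by apply/seteqP; split=> [x []|x ?].
by rewrite (_ : _ `&` _ = set0)//; apply/seteqP; split=> x // [_ /nYk].
Qed.

(** On [[0, 1[] a rotation exchanges two intervals, each moved by a translation. *)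
Lemma fracD (x c : R) : 0 <= x < 1 ->
  frac (x + c) = if x + frac c < 1 then x + frac c else x + frac c - 1.
Proof.
move=> /andP[x0 x1]; have /andP[f0 f1] := floor_itv c.
move: f1; rewrite intrD => f1; rewrite /frac.
case: ifPn => [h|]; last rewrite -leNgt => h.
  rewrite (@floor_def _ (x + c) (Num.floor c)); first by lra.
  by rewrite intrD; apply/andP; split; lra.
rewrite (@floor_def _ (x + c) (Num.floor c + 1)); first by rewrite intrD; lra.
by rewrite !intrD; apply/andP; split; lra.
Qed.

Lemma frac_itv c : 0 <= frac c < 1.
Proof.
by have /andP[] := floor_itv c; rewrite /frac intrD => ? ?; apply/andP; split; lra.
Qed.

Lemma cos_periodz (a : R) (m : int) : cos (a + m%:~R * (2 * pi)) = cos a.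
Proof.
have nat_case (n : nat) (b : R) : cos (b + n%:R * (2 * pi)) = cos b.
  elim: n b => [|n IH] b; first by rewrite mul0r addr0.
  rewrite -(natr1 n) mulrDl mul1r addrA.
  by rewrite [X in _ + X](mulr_natl pi 2) cosD2pi; exact: IH.
case: m => n; first exact: nat_case.
by rewrite -(nat_case n.+1) NegzE mulrNz; congr cos; ring.
Qed.

(** The circle is modelled by the line with the uniform law of the unit interval as Haar measure,
    rotations acting through [frac]. *)
Definition uniform01 : set (measurableTypeR R) -> \bar R := uniform_prob (@ltr01 R).
HB.instance Definition _ := Probability.on uniform01.

Lemma uniform01E (A : set R) : measurable A ->
  uniform01 A = leb (A `&` `[0, 1[).
Proof.
move=> mA; rewrite /uniform01 /uniform_prob integral_uniform_pdf.
rewrite (eq_integral (fun=> 1%:E)); last first.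
  move=> x; rewrite inE /= => -[_]; rewrite in_itv/= /uniform_pdf => ->.
  by rewrite subr0 invr1.
rewrite integral_cst/=; last exact: measurableI.
rewrite mul1e; apply/eqP; rewrite eq_le; apply/andP; split; last first.
  apply: le_measure; rewrite ?inE; [exact: measurableI|exact: measurableI|].
  by apply: setIS => x /=; rewrite !in_itv/= => /andP[-> /ltW].
apply: (@le_trans _ _ (leb ((A `&` `[0, 1[) `|` [set 1]))).
  apply: le_measure; rewrite ?inE; [exact: measurableI| |].
    by apply: measurableU => //; exact: measurableI.
  move=> x [Ax] /=; rewrite !in_itv/= => /andP[x0].
  by rewrite le_eqVlt => /predU1P[->|x1]; [right|left; rewrite /= x0].
have mA1 : measurable (A `&` `[0, 1[) by exact: measurableI.
have := measureU2 leb mA1 (measurable_set1 1).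
by rewrite [X in (_ <= _ + X)%E -> _]lebesgue_measure_set1 adde0.
Qed.

(** The preimage splits into translates of the two pieces of [B] cut at the fractional part of [c],
    and Lebesgue measure is invariant under translation. *)
Lemma uniform01_rotation (c : R) (B : set R) : measurable B ->
  uniform01 [set x | B (frac (x + c))] = uniform01 B.
Proof.
move=> mB; have /andP[c0 c1] := frac_itv c; set c' := frac c in c0 c1.
have mrot : measurable [set x | B (frac (x + c))].
  have := measurableT_comp measurable_frac (measurable_addr_cst c).
  by move=> /(_ measurableT _ mB); rewrite setTI.
rewrite !uniform01E//.
have m1 : measurable (B `&` `[c', 1[) by exact: measurableI.
have m2 : measurable (B `&` `[0, c'[) by exact: measurableI.
rewrite (_ : _ `&` _ = (fun x => x + c') @^-1` (B `&` `[c', 1[) `|`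
    (fun x => x + (c' - 1)) @^-1` (B `&` `[0, c'[)); last first.
  apply/seteqP; split=> [x [/= Bx]|x [|] [/= Bx]]; rewrite /= !in_itv/=.
  - move=> x01; move: Bx; rewrite fracD//= -/c'; move: x01 => /andP[x0 x1].
    case: ifPn => [h Bx|]; [left|rewrite -leNgt => h; right].
      by split=> //; apply/andP; split; lra.
    by rewrite addrA; split=> //; apply/andP; split; lra.
  - move=> /andP[h1 h2]; have x01 : 0 <= x < 1 by apply/andP; split; lra.
    by rewrite x01 fracD//= -/c' h2.
  - move=> /andP[h1 h2]; have x01 : 0 <= x < 1 by apply/andP; split; lra.
    rewrite x01 fracD//= -/c' ifF; first by rewrite -addrA.
    by apply/negbTE; rewrite -leNgt; lra.
rewrite measureU/=; last 3 first.
- by rewrite -[X in measurable X]setTI; exact: measurable_addr_cst.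
- by rewrite -[X in measurable X]setTI; exact: measurable_addr_cst.
- apply/seteqP; split=> // x [[_ /=]] + [_ /=]; rewrite !in_itv/=.
  by move=> /andP[? ?] /andP[? ?]; lra.
rewrite !lebesgue_measure_translation// addeC -measureU//; last first.
  apply/seteqP; split=> // x [[_ /=]] + [_ /=]; rewrite !in_itv/=.
  by move=> /andP[? ?] /andP[? ?]; lra.
rewrite -setIUr; congr (leb (_ `&` _)).
apply/seteqP; split=> x /=; rewrite !in_itv/=.
  by case=> /andP[? ?]; apply/andP; split; lra.
by move=> /andP[? ?]; case: (ltP x c') => ?; [left|right]; apply/andP.
Qed.

End circle.

Section ae_product.
Context {R : realType} d1 d2 {X : measurableType d1} {Y : measurableType d2}.
Variables (m1 : {measure set X -> \bar R}) (m2 : {sigma_finite_measure set Y -> \bar R}).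

Lemma ae_xsection0 (N : set (X * Y)) : measurable N -> (m1 \x m2)%E N = 0%E ->
  {ae m1, forall x, m2 (xsection N x) = 0%E}.
Proof.
move=> mN N0.
have mphi := measurable_fun_xsection m2 mN.
have : (\int[m1]_x `|(m2 \o xsection N) x| = 0)%E.
  by rewrite -[RHS]N0; apply: eq_integral => x _; rewrite gee0_abs.
move/(ae_eq_integral_abs m1 measurableT mphi).
by apply: filterS => x /(_ I).
Qed.

End ae_product.

Section skew_product.
Context {R : realType} d {X : measurableType d}.
Variables (mu : probability X R) (S : X -> X).
Hypothesis Smu : invariant_measure mu S.
Variable phi : X -> R.
Hypothesis mphi : measurable_fun setT phi.

Definition skew (p : X * measurableTypeR R) : X * measurableTypeR R :=
  (S p.1, frac (p.2 + phi p.1)).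

Definition skew_measure :=
  product_subprobability ((mu : subprobability X R),
    (uniform01 : subprobability (measurableTypeR R) R)).

(** Each fibre is rotated, which preserves the uniform law, and the base is moved by [S]; integrate
    the measures of the sections. *)
Lemma skew_invariant : invariant_measure skew_measure skew.
Proof.
have mskew : measurable_fun setT skew.
  apply/measurable_fun_pairP; split.
    exact: (measurableT_comp Smu.1 measurable_fst).
  apply: (measurableT_comp measurable_frac).
  apply: measurable_funD; first exact: measurable_snd.
  exact: (measurableT_comp mphi measurable_fst).
split=> [|A mA]; first exact: mskew.
have mB : measurable (skew @^-1` A).
  by rewrite -[X in measurable X]setTI; exact: mskew.
rewrite /skew_measure /product_subprobability /= /product_measure1.
transitivity (\int[mu]_x (uniform01 \o xsection A) (S x))%E.
  apply: eq_integral => x _ /=.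
  rewrite -(uniform01_rotation (phi x) (measurable_xsection (S x) mA)).
  by congr uniform01; apply/seteqP; split=> y; rewrite /xsection/= !inE.
apply: (ge0_integral_invariant Smu (g := uniform01 \o xsection A)) => //.
exact: measurable_fun_xsection.
Qed.

(** With [phi] constant on the orbit, [k] rotations make one rotation by [k%:R * phi x], up to an
    integer that the cosine does not see. *)
Lemma iter_skew x y k : (forall j, phi (iter j S x) = phi x) ->
  exists m : int, iter k skew (x, y) = (iter k S x, y + k%:R * phi x - m%:~R).
Proof.
move=> inv; elim: k => [|k [m IH]]; first by exists 0; rewrite /= mul0r addr0 subr0.
exists (m + Num.floor (y + k%:R * phi x - m%:~R + phi x)).
rewrite iterS IH /skew/= inv /frac intrD; congr pair.
by rewrite -(natr1 k); ring.
Qed.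

(** Birkhoff for [F b] holds at almost every [(x, y)], hence for almost every [x] at some [y]. The
    phase [2 * pi * y] is then rotated away by combining two quadratures, which yields every [alpha]
    off one null set. *)
Lemma birkhoff_twisted (f : X -> R) (M : R) : measurable_fun setT f ->
  (forall x, `|f x| <= M) ->
  {ae mu, forall x, (forall k, phi (iter k S x) = phi x) ->
    forall alpha, cvgn (cesaro (fun k => f (iter k S x) *
      cos (k%:R * (2 * pi * phi x) + alpha)))}.
Proof.
move=> mf fM.
pose F (b : R) (p : X * measurableTypeR R) := f p.1 * cos (2 * pi * p.2 + b).
have mF b : measurable_fun setT (F b).
  apply: measurable_funM; first exact: (measurableT_comp mf measurable_fst).
  apply: (measurableT_comp (continuous_measurable_fun (@continuous_cos R))).
  by apply: measurable_funD => //; apply: measurable_funM.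
have FM b p : `|F b p| <= M.
  by rewrite /F normrM -[M]mulr1 ler_pM// norm_cos_le1.
have [g1 _ [N1 [mN1 N10 FN1]]] := birkhoff_bounded skew_invariant (mF 0) (FM 0).
have [g2 _ [N2 [mN2 N20 FN2]]] :=
  birkhoff_bounded skew_invariant (mF (- (pi / 2))) (FM (- (pi / 2))).
have mN : measurable (N1 `|` N2) by exact: measurableU.
have N0 : (mu \x uniform01)%E (N1 `|` N2) = 0%E.
  have h0 : skew_measure (N1 `|` N2) = 0%E.
    apply/eqP; rewrite eq_le measure_ge0 andbT.
    apply: le_trans (measureU2 skew_measure mN1 mN2) _.
    rewrite [X in (X + _)%E](_ : _ = 0%E); last exact: N10.
    by rewrite [X in (_ + X)%E](_ : _ = 0%E) ?adde0//; exact: N20.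
  exact: h0.
have := ae_xsection0 mN N0; apply: filterS => x x0 inv alpha.
(* A null section cannot be the whole fibre, which has mass 1. *)
have [y Ny] : exists y, ~ (N1 `|` N2) (x, y).
  apply: contrapT => /forallNP ally.
  have U1 : uniform01 (xsection (N1 `|` N2) x) = 1%E.
    rewrite (_ : xsection _ _ = setT) ?probability_setT//.
    apply/seteqP; split=> // y _; rewrite /xsection/= inE.
    by apply: contrapT; exact: ally.
  have : (1 = 0 :> \bar R)%E by rewrite -U1; exact: x0.
  by move/eqP; rewrite onee_eq0.
have Fk b k : F b (iter k skew (x, y)) =
    f (iter k S x) * cos (k%:R * (2 * pi * phi x) + (2 * pi * y + b)).
  have [m ->] := iter_skew y k inv; rewrite /F/=; congr (_ * _).
  rewrite -[RHS](cos_periodz _ (- m)); congr cos.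
  by rewrite mulrNz; ring.
have c1 : cesaro (fun k => F 0 (iter k skew (x, y))) @ \oo --> g1 (x, y).
  by apply: contrapT => h; apply: Ny; left; exact: FN1.
have c2 : cesaro (fun k => F (- (pi / 2)) (iter k skew (x, y))) @ \oo --> g2 (x, y).
  by apply: contrapT => h; apply: Ny; right; exact: FN2.
(* [de] turns the phase left by [y] into [alpha] through the addition formula. *)
pose de := alpha - 2 * pi * y.
apply/cvg_ex; exists (cos de * g1 (x, y) - sin de * g2 (x, y)).
rewrite (_ : cesaro _ = fun n => cos de * cesaro (fun k => F 0 (iter k skew (x, y))) n -
    sin de * cesaro (fun k => F (- (pi / 2)) (iter k skew (x, y))) n).
  by apply: cvgB; apply: cvgMr.
apply/funext => n; rewrite -!cesaroZl -cesaroB; congr (cesaro _ _).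
apply/funext => k; rewrite !Fk.
have -> : k%:R * (2 * pi * phi x) + alpha = k%:R * (2 * pi * phi x) + 2 * pi * y + de.
  by rewrite /de; ring.
clearbody de; by rewrite !addrA addr0 cosBpihalf [in LHS]cosD; ring.
Qed.

End skew_product.

(** * Measurable selection of the atoms *)

Section level_sets.
Context {R : realType}.

Lemma cvg_cesaro_shift (u : nat -> R) (M l : R) j : (forall k, `|u k| <= M) ->
  cesaro u @ \oo --> l -> cesaro (fun k => u (k + j)%N) @ \oo --> l.
Proof.
move=> uM ul; rewrite -[l]add0r.
rewrite (_ : cesaro (fun k => _) = fun n =>
    (cesaro (fun k => u (k + j)%N) n - cesaro u n) + cesaro u n); last first.
  by apply/funext => n; rewrite subrK.
apply: cvgD => //; apply/cvgrPdist_le => e e0.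
pose C := 2 * j%:R * M.
exists (Num.trunc (C / e)).+1 => // n /= hn; rewrite sub0r normrN.
have nR : 0 < n%:R :> R by rewrite ltr0n (leq_trans _ hn).
rewrite /cesaro -mulrBr normrM ger0_norm ?invr_ge0// ler_pdivrMl//.
apply: le_trans (ler_norm_sum_shift n j uM) _.
rewrite -ler_pdivrMr//; apply/ltW/(lt_le_trans (truncnS_gt _)).
by rewrite ler_nat.
Qed.

(* A countable description of [exists theta in [a, r], forall m, e <= G m theta]
   that makes it measurable in parameters on which [G] depends. *)
Definition level_test (G : nat -> R -> R) (e a r : R) : Prop :=
  forall n, exists q : rat, [/\ a <= ratr q, ratr q <= r &
    forall m, (m <= n)%N -> (0 < m)%N -> e - n.+1%:R^-1 < G m (ratr q)].

(** Forward: the rationals [q n] cluster in the compact segment, and continuity passes the bounds to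
    a cluster point. Backward: the slack [n.+1%:R^-1] turns finitely many conditions into open ones,
    met by a rational near [theta]. *)
Lemma level_testP (G : nat -> R -> R) (e a r : R) :
  (forall m, continuous (G m)) -> a < r ->
  level_test G e a r <->
  exists theta, [/\ a <= theta, theta <= r & forall m, (0 < m)%N -> e <= G m theta].
Proof.
move=> cG ar; split=> [test|[th [ath thr eG]] n].
  have [q hq] := choice test.
  pose F := (fun n => ratr (q n) : R) @ \oo.
  have [|th [/=]] := @segment_compact R a r F _.
    by exists 0%N => // n _; rewrite /= in_itv/=; have [-> ->] := hq n.
  rewrite in_itv/= => /andP[ath thr] clF; exists th; split=> // m m0.
  rewrite leNgt; apply/negP => lt.
  pose d := (e - G m th) / 2; have d0 : 0 < d by rewrite divr_gt0// subr_gt0.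
  have [t [[n /= nN <-] /= Gt]] : [set ratr (q n) | n in
      [set n | (maxn m (Num.trunc d^-1) <= n)%N]] `&` [set t | G m t < e - d] !=set0.
    apply: clF.
      by exists (maxn m (Num.trunc d^-1)) => // n /= nN; exists n.
    by apply: (cvgr_lt (G m th) (cG m th)); rewrite /d; lra.
  move: nN; rewrite geq_max => /andP[mn dn].
  have [_ _ /(_ m mn m0)] := hq n.
  have : n.+1%:R^-1 <= d.
    rewrite invf_ple ?posrE//; apply/ltW/(lt_le_trans (truncnS_gt _)).
    by rewrite ler_nat.
  by move: Gt; set s := n.+1%:R^-1; clearbody s; lra.
have e' : 0 < n.+1%:R^-1 :> R by rewrite invr_gt0.
have nb : \forall t \near th, forall m, (m <= n)%N -> (0 < m)%N -> e - n.+1%:R^-1 < G m t.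
  have : \forall t \near th, forall i : 'I_n.+1, (0 < i)%N -> e - n.+1%:R^-1 < G i t.
    apply: (@filter_forall R _
      (fun (i : 'I_n.+1) t => (0 < i)%N -> e - n.+1%:R^-1 < G i t) (nbhs th) _) => i.
    have [i0|i0] := boolP (0 < i)%N; last by apply: nearW.
    have lt : e - n.+1%:R^-1 < G i th by apply: lt_le_trans (eG i i0); rewrite gtrBl.
    have h : \forall t \near th, e - n.+1%:R^-1 < G i t.
      exact: (cvgr_gt (G i th) (cG i th)).
    by apply: filterS h => t ht _.
  by apply: filterS => t ht m mn m0; have := ht (Ordinal (mn : (m < n.+1)%N)) m0.
have /nbhs_ballP [dl dl0 hdl] := nb.
(* By [a < r] this holds even when [th] is an endpoint of the segment. *)
have lt : Num.max a (th - dl) < Num.min r (th + dl).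
  rewrite gt_max !lt_min ar /=; move: dl0 => /= dl0.
  by apply/and3P; split; lra.
have [q] := rat_in_itvoo lt; rewrite in_itv/= gt_max lt_min.
move=> /andP[/andP[aq dq] /andP[qr qd]]; exists q; split; [exact: ltW|exact: ltW|].
by apply: hdl; rewrite /ball/= ltr_distl; apply/andP; split; lra.
Qed.

Lemma continuous_mean_energy (c : nat -> nat -> R) H : continuous (mean_energy c H).
Proof.
move=> th; rewrite /mean_energy; apply: cvgMr.
have key (I : Type) (s : seq I) (F : I -> R -> R) : (forall i, continuous (F i)) ->
    continuous (fun t => \sum_(i <- s) F i t).
  move=> cF; elim: s => [|i s IH].
    rewrite (_ : (fun t => _) = fun=> 0); first by move=> t; exact: cvg_cst.
    by apply/funext => t; rewrite big_nil.
  rewrite (_ : (fun t => _) = fun t => F i t + \sum_(j <- s) F j t).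
    by move=> t; apply: cvgD; [exact: cF|exact: IH].
  by apply/funext => t; rewrite big_cons.
apply: (key _ _ (fun (h : 'I_H) t => \sum_(h' < H) c h h' * cos ((h%:R - h'%:R) * t))) => h.
apply: (key _ _ (fun (h' : 'I_H) t => c h h' * cos ((h%:R - h'%:R) * t))) => h' t.
have cc : continuous (fun u : R => cos ((h%:R - h'%:R) * u)).
  move=> u; apply: (@continuous_cvg R R R (nbhs u) _ ( *%R (h%:R - h'%:R)) cos _).
    exact: continuous_cos.
  by apply: cvgMr; exact: cvg_id.
by apply: cvgMr; exact: cc.
Qed.

End level_sets.

Section first_level.
Context {R : realType}.

(** The value [+oo] is neutral for the infimum: it stands for numbers that code no rational and for
    rationals that fail the test. *)
Definition level_candidate (G : nat -> R -> R) (e a : R) (n : nat) : \bar R :=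
  if unpickle n is Some q then
    if (a < ratr (q : rat)) && `[< level_test G e a (ratr q) >]
    then (ratr q)%:E else +oo%E
  else +oo%E.

Definition first_level (G : nat -> R -> R) (e a : R) : R :=
  fine (einfs (level_candidate G e a) 0%N).

(** Rationals just above [theta] pass the test because [theta] witnesses it; one below [theta]
    fails, since a witness would lie in [[a, theta[], where some energy is below [e]. *)
Lemma first_levelE (G : nat -> R -> R) (e a theta : R) :
  (forall m, continuous (G m)) -> a < theta ->
  (forall m, (0 < m)%N -> e <= G m theta) ->
  (forall t, a <= t < theta -> exists2 m : nat, (0 < m)%N & G m t < e) ->
  first_level G e a = theta.
Proof.
move=> cG ath eG before; rewrite /first_level /einfs /=.
rewrite (_ : ereal_inf _ = theta%:E)//; apply/eqP; rewrite eq_le; apply/andP; split.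
  apply/lee_addgt0Pr => d d0.
  have [|q] := @rat_in_itvoo R theta (theta + d); first by lra.
  rewrite in_itv/= => /andP[q1 q2].
  apply: (@le_trans _ _ (ratr q)%:E); last by rewrite -EFinD lee_fin ltW.
  apply: ereal_inf_lbound; exists (pickle q) => //.
  rewrite /level_candidate pickleK ifT//; apply/andP; split; first by lra.
  apply/asboolP/level_testP => //; first by lra.
  by exists theta; split=> //; exact: ltW.
apply: le_ereal_inf_tmp => _ [n _ <-]; rewrite /level_candidate.
case: (unpickle n) => [q|]; last exact: leey.
case: ifPn => [/andP[aq /asboolP test]|_]; last exact: leey.
rewrite lee_fin leNgt; apply/negP => qth.
have [t [at_ tq le]] := (level_testP e cG aq).1 test.
have [|m m0] := before t; first by rewrite at_ (le_lt_trans tq).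
by rewrite ltNge le.
Qed.

Lemma measurable_first_level d (X : measurableType d) (G : X -> nat -> R -> R)
    (e a : R) : (forall m t, measurable_fun setT (fun x => G x m t)) ->
  measurable_fun setT (fun x => first_level (G x) e a).
Proof.
move=> mG; apply: measurableT_comp; first exact: fine_measurable.
apply: (measurable_fun_einfs (f := fun n x => level_candidate (G x) e a n)) => n.
rewrite /level_candidate; case: (unpickle n) => [q|]; last exact: measurable_cst.
have mtest : measurable [set x | level_test (G x) e a (ratr q)].
  have -> : [set x | level_test (G x) e a (ratr q)] =
      \bigcap_k \bigcup_(p : rat) \bigcap_m [set x : X |
        [/\ a <= ratr p :> R, ratr p <= ratr q :> R & (m <= k)%N -> (0 < m)%N ->
         e - k.+1%:R^-1 < G x m (ratr p)]].
    apply/seteqP; split=> [x h k _|x h k].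
      by have [p [p1 p2 p3]] := h k; exists p => // m _; split=> //; exact: p3.
    have [p _ hp] := h k I; exists p; have [p1 p2 _] := hp 0%N I; split=> // m mk m0.
    by have [_ _] := hp m I; apply.
  apply: bigcapT_measurable => k.
  apply: countable_bigcupT_measurable => [|p]; first exact: countableP.
  apply: bigcapT_measurable => m.
  have [h|h] := pselect [/\ a <= ratr p, ratr p <= ratr q :> R, (m <= k)%N & (0 < m)%N].
    rewrite (_ : mkset _ = [set x | e - k.+1%:R^-1 < G x m (ratr p)]).
      exact: measurable_set_ltr.
    by case: h => *; apply/seteqP; split=> x /= => [[_ _]|?]; [apply|split].
  have [[h1 h2]|h'] := pselect (a <= ratr p /\ ratr p <= ratr q :> R).
    rewrite (_ : mkset _ = setT)//; apply/seteqP; split=> // x _; split=> // mk m0.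
    by exfalso; apply: h.
  by rewrite (_ : mkset _ = set0)//; apply/seteqP; split=> // x [h1 h2 _]; apply: h'.
apply: measurable_fun_if => //; apply: (measurable_fun_bool true).
rewrite setTI; have [aq|aq] := boolP (a < ratr q).
  rewrite (_ : _ @^-1` _ = [set x | level_test (G x) e a (ratr q)])//.
  by apply/seteqP; split=> x /= /asboolP.
by rewrite (_ : _ @^-1` _ = set0)//; apply/seteqP; split.
Qed.

End first_level.

(** * The discrete theorem for bounded functions *)

Section wiener_wintner_bounded.
Context {R : realType} d {X : measurableType d}.
Variables (mu : probability X R) (S : X -> X).
Hypothesis Smu : invariant_measure mu S.

(** Birkhoff for the product of [f] along two shifts; countably many pairs share one null set.
    Measurability of the limits makes the energies measurable in the point. *)
Lemma autocorrelations (f : X -> R) (M : R) : measurable_fun setT f ->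
  (forall x, `|f x| <= M) ->
  exists2 c : nat -> nat -> X -> R, forall h h', measurable_fun setT (c h h') &
    {ae mu, forall x, forall h h', cesaro (fun k =>
      f (iter (k + h) S x) * f (iter (k + h') S x)) @ \oo --> c h h' x}.
Proof.
move=> mf fM.
have cor h h' : exists c : X -> R, measurable_fun setT c /\
   {ae mu, forall x, cesaro (fun k =>
      f (iter (k + h) S x) * f (iter (k + h') S x)) @ \oo --> c x}.
  have mp : measurable_fun setT (fun x => f (iter h S x) * f (iter h' S x)).
    by apply: measurable_funM; exact: (measurableT_comp mf (measurable_iter Smu _)).
  have pM x : `|f (iter h S x) * f (iter h' S x)| <= M * M.
    by rewrite normrM ler_pM.
  have [c mc hc] := birkhoff_bounded Smu mp pM.
  exists c; split=> //; apply: filterS hc => x.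
  by under eq_fun => k do rewrite -!iterD (addnC h) (addnC h').
have [c hc] := choice (fun p : nat * nat => cor p.1 p.2).
exists (fun h h' => c (h, h')); first by move=> h h'; have [] := hc (h, h').
by apply: ae_foralln => h; apply: ae_foralln => h'; have [] := hc (h, h').
Qed.

Theorem wiener_wintner_bounded (f : X -> R) (M : R) : measurable_fun setT f ->
  (forall x, `|f x| <= M) ->
  {ae mu, forall x, forall theta alpha,
    cvgn (cesaro (fun k => f (iter k S x) * cos (k%:R * theta + alpha)))}.
Proof.
move=> mf fM; have [c mc aec] := autocorrelations mf fM.
pose G x m t := mean_energy (fun h h' => c h h' x) m t.
have mG m t : measurable_fun setT (fun x => G x m t).
  apply: measurable_funM => //; apply: measurable_sum => h.
  by apply: measurable_sum => h'; apply: measurable_funM.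
have cG x m : continuous (G x m) by exact: continuous_mean_energy.
(* Divided by [2 * pi] because the circle of the skew product has length 1. *)
pose phi (p : rat * rat) x := first_level (G x) (ratr p.1) (ratr p.2) / (2 * pi).
have mphi p : measurable_fun setT (phi p).
  by apply: measurable_funM => //; exact: measurable_first_level.
have tw : {ae mu, forall x, forall n p, unpickle n = Some p ->
    (forall k, phi p (iter k S x) = phi p x) -> forall alpha,
    cvgn (cesaro (fun k => f (iter k S x) * cos (k%:R * (2 * pi * phi p x) + alpha)))}.
  apply: ae_foralln => n; case: (unpickle n) => [p|]; last exact: aeW.
  by apply: filterS (birkhoff_twisted Smu (mphi p) mf fM) => x h _ [<-].
have aec_iter := ae_iter Smu aec.
apply: filterS2 tw aec_iter => x twx cx theta alpha.
have xM k : `|f (iter k S x)| <= M by [].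
have hc : forall h h', cesaro (fun k => f (iter (k + h) S x) * f (iter (k + h') S x))
    @ \oo --> c h h' x by exact: (cx 0%N).
have [small|] := pselect (forall e : R, 0 < e ->
    exists2 H : nat, (0 < H)%N & G x H theta < e).
  apply/cvg_ex; exists 0.
  exact: (cvg_cesaro_twist0 (x := fun k => f (iter k S x)) alpha xM hc small).
move=> /existsNP [e0 /not_implyP [e0_gt0 big]].
have [e] := rat_in_itvoo e0_gt0; rewrite in_itv/= => /andP[e_gt0 ee0].
have eG m : (0 < m)%N -> ratr e <= G x m theta.
  move=> m0; rewrite leNgt; apply/negP => lt; apply: big; exists m => //.
  exact: lt_trans lt ee0.
have [a' a'th before] :=
  mean_energy_isolated (x := fun k => f (iter k S x)) theta xM hc e_gt0.
have [a] := rat_in_itvoo a'th; rewrite in_itv/= => /andP[a'a ath].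
(* A shifted orbit has the same autocorrelations, so the energies, and with them [phi], are constant
   along the orbit. *)
have cinv k h h' : c h h' (iter k S x) = c h h' x.
  have pM j : `|f (iter (j + h) S x) * f (iter (j + h') S x)| <= M * M.
    by rewrite normrM ler_pM.
  have l2 := cvg_cesaro_shift k pM (hc h h').
  have l1 := cx k h h'.
  have E : (fun j => f (iter (j + h) S (iter k S x)) * f (iter (j + h') S (iter k S x)))
      = fun j => f (iter (j + k + h) S x) * f (iter (j + k + h') S x).
    by apply/funext => j; rewrite -!iterD (addnAC j h) (addnAC j h').
  rewrite E in l1; exact: (cvg_unique _ l1 l2).
have first_theta : first_level (G x) (ratr e) (ratr a) = theta.
  apply: first_levelE => // t /andP[at_ tth].
  by apply: before; rewrite tth (le_trans (ltW a'a)).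
have phix k : phi (e, a) (iter k S x) = phi (e, a) x.
  rewrite /phi/= (_ : G (iter k S x) = G x)//.
  apply/funext => m; apply/funext => t; rewrite /G; congr mean_energy.
  by apply/funext => h; apply/funext => h'; exact: cinv.
have := twx (pickle (e, a)) (e, a) (pickleK _) phix alpha.
have -> : 2 * pi * phi (e, a) x = theta.
  rewrite /phi/= first_theta mulrCA divff ?mulr1// mulf_neq0//.
  by rewrite gt_eqF// pi_gt0.
by [].
Qed.

End wiener_wintner_bounded.

(** * Integrable functions *)

Section wiener_wintner.
Context {R : realType} d {X : measurableType d}.
Variables (mu : probability X R) (S : X -> X).
Hypothesis Smu : invariant_measure mu S.

(** Cut to 0 rather than clipped, so that the residual is either 0 or [f]. *)
Definition truncation (f : X -> R) (M : R) (x : X) : R :=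
  if `|f x| <= M then f x else 0.

Lemma measurable_truncation (f : X -> R) M : measurable_fun setT f ->
  measurable_fun setT (truncation f M).
Proof.
move=> mf; apply: measurable_fun_if => //.
  by apply: measurable_fun_ler => //; exact: measurableT_comp.
exact: measurable_funTS.
Qed.

Lemma truncation_le (f : X -> R) M x : 0 <= M -> `|truncation f M x| <= M.
Proof. by move=> M0; rewrite /truncation; case: ifP => //; rewrite normr0. Qed.

Lemma truncation_residual_le (f : X -> R) M x : `|f x - truncation f M x| <= `|f x|.
Proof. by rewrite /truncation; case: ifP; rewrite ?subrr ?normr0 ?subr0. Qed.

Lemma integrable_truncation_residual (f : X -> R) M :
  mu.-integrable setT (EFin \o f) ->
  mu.-integrable setT (EFin \o fun x => `|f x - truncation f M x|).
Proof.
move=> intf; apply: (le_integrable measurableT _ _ intf).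
  apply/measurable_EFinP; apply: measurableT_comp => //.
  have mf : measurable_fun setT f by apply/measurable_EFinP; exact: measurable_int intf.
  by apply: measurable_funB => //; exact: measurable_truncation.
by move=> x _; rewrite lee_fin normr_id truncation_residual_le.
Qed.

Lemma cvg_truncation_residual (f : X -> R) : mu.-integrable setT (EFin \o f) ->
  \int[mu]_x `|f x - truncation f n%:R x| @[n --> \oo] --> (0 : R).
Proof.
move=> intf.
suff : (\int[mu]_x (`|f x - truncation f n%:R x|)%:E)%E @[n --> \oo] -->
    (\int[mu]_x (cst 0 x))%E by rewrite integral0 => /fine_cvg.
apply: (@dominated_cvg _ _ _ mu setT measurableT _ _ (fun x => `|(f x)%:E|%E)) => //.
- by move=> n; exact: measurable_int (integrable_truncation_residual n%:R intf).
- move=> x _; apply: cvg_near_cst.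
  exists (Num.trunc `|f x|).+1 => // n /= hn.
  rewrite /truncation ifT ?subrr ?normr0//.
  by apply/ltW/(lt_le_trans (truncnS_gt _)); rewrite ler_nat.
- exact: integrable_abse.
- by move=> n x _; rewrite lee_fin normr_id truncation_residual_le.
Qed.

(** Averages of the residual bound the twisted ones at every frequency. By the weak maximal
    inequality, their supremum exceeds [e] for all [M] only on a null set, as the residual norms
    tend to 0; elsewhere each level has one good [M] for all frequencies. *)
Theorem wiener_wintner_integrable (f : X -> R) : mu.-integrable setT (EFin \o f) ->
  {ae mu, forall x, forall theta alpha,
    cvgn (cesaro (fun k => f (iter k S x) * cos (k%:R * theta + alpha)))}.
Proof.
move=> intf.
have mf : measurable_fun setT f by apply/measurable_EFinP; exact: measurable_int intf.
pose r M x := `|f x - truncation f M%:R x|.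
have aebd : {ae mu, forall x, forall M theta alpha, cvgn (cesaro (fun k =>
    truncation f M%:R (iter k S x) * cos (k%:R * theta + alpha)))}.
  apply: ae_foralln => M.
  by apply: (@wiener_wintner_bounded _ _ _ _ _ Smu _ M%:R) => [|x];
    [exact: measurable_truncation|exact: truncation_le].
pose B (e : R) (M : nat) := [set x | exists n, e < cesaro (fun k => r M (iter k S x)) n].
have mr M : measurable_fun setT (r M).
  by apply/measurable_EFinP; exact: measurable_int (integrable_truncation_residual M%:R intf).
have mB e M : measurable (B e M).
  rewrite (_ : B e M = \bigcup_n [set x | e < cesaro (fun k => r M (iter k S x)) n]).
    apply: bigcupT_measurable => n; apply: measurable_set_ltr => //.
    exact: (measurable_cesaro Smu).
  by apply/seteqP; split=> [x [n h]|x [n _ h]]; exists n.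
have muB (e : R) : 0 < e -> mu (\bigcap_M B e M) = 0%E.
  move=> e0; have mBB : measurable (\bigcap_M B e M) by apply: bigcapT_measurable.
  have fB : mu (\bigcap_M B e M) \is a fin_num by exact: fin_num_measure.
  suff : fine (mu (\bigcap_M B e M)) <= 0.
    move=> le0; rewrite -(fineK fB); congr _%:E; apply/eqP.
    by rewrite eq_le le0 fine_ge0.
  have : (fun n => e^-1 * \int[mu]_x r n x) @ \oo --> (e^-1 * 0 : R).
    by apply: cvgMr; exact: cvg_truncation_residual.
  rewrite mulr0 => /cvgr_to_ge; apply; apply: nearW => n.
  rewrite ler_pdivlMl//.
  apply: le_trans (weak_maximal_inequality Smu
    (integrable_truncation_residual n%:R intf) (fun x => normr_ge0 _) e0).
  rewrite ler_pM2l//; apply: fine_le => //.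
    exact: fin_num_measure (mB e n).
  apply: le_measure; rewrite ?inE//; first exact: mB e n.
  by move=> x /(_ n I).
have aeB : {ae mu, forall x, forall j : nat, exists M, forall n,
    cesaro (fun k => r M (iter k S x)) n <= j.+1%:R^-1}.
  apply: ae_foralln => j; exists (\bigcap_M B j.+1%:R^-1 M); split.
  - exact: bigcapT_measurable.
  - by apply: muB; rewrite invr_gt0.
  - move=> x /= h M _ /=; apply: contrapT => nB; apply: h; exists M => n.
    by rewrite leNgt; apply/negP => lt; apply: nB; exists n.
apply: filterS2 aebd aeB => x cv hB theta alpha.
apply: is_cvg_uniform_approx => e e0.
have [M hM] := hB (Num.trunc e^-1).
exists (cesaro (fun k => truncation f M%:R (iter k S x) * cos (k%:R * theta + alpha))).
  exact: cv.
move=> n; rewrite -cesaroB; apply: le_trans (le_normr_cesaro _ _) _.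
apply: (@le_trans _ _ (cesaro (fun k => r M (iter k S x)) n)).
  apply: le_cesaro => k; rewrite -mulrBl normrM -[leRHS]mulr1.
  by rewrite ler_wpM2l// norm_cos_le1.
apply: le_trans (hM n) _.
by rewrite invf_ple ?posrE//; exact/ltW/truncnS_gt.
Qed.

End wiener_wintner.

(** * From discrete to continuous time *)

Lemma integrable_setU_disjoint (R : realType) d (X : measurableType d)
    (mu : {measure set X -> \bar R}) (A B : set X) (g : X -> \bar R) :
  measurable A -> measurable B -> [disjoint A & B] ->
  mu.-integrable A g -> mu.-integrable B g -> mu.-integrable (A `|` B) g.
Proof.
move=> mA mB AB /integrableP[mgA gA] /integrableP[mgB gB].
have mg : measurable_fun (A `|` B) g by apply/measurable_funU.
apply/integrableP; split=> //; rewrite ge0_integral_setU//.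
  by rewrite lte_add_pinfty.
exact: measurableT_comp.
Qed.

Section time_averages.
Context {R : realType}.
Local Notation leb := (@lebesgue_measure R).

Lemma ler_dist_cos (a b : R) : `|cos a - cos b| <= `|a - b|.
Proof.
wlog ab : a b / a <= b.
  move=> H; have [ab|/ltW ba] := leP a b; first exact: H.
  by rewrite distrC (distrC a); exact: H.
rewrite distrC (distrC a).
have [x _ ->] : exists2 c, c \in `[a, b] & cos b - cos a = - sin c * (b - a).
  apply: (@MVT_segment R cos (fun x => - sin x)) => //.
  by apply: continuous_subspaceT => x; exact: continuous_cos.
rewrite normrM normrN -[leRHS]mul1r ler_wpM2r//; exact: norm_sin_le1.
Qed.

Lemma integrable_translation (g : R -> R) (k : R) : measurable_fun setT g ->
  leb.-integrable `[0, 1[ (EFin \o (fun t => g (t + k))) ->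
  leb.-integrable `[k, k + 1[ (EFin \o g) /\
  \int[leb]_(t in `[k, k + 1[) g t = \int[leb]_(t in `[0, 1[) g (t + k).
Proof.
move=> mg ig; pose phi (t : measurableTypeR R) : measurableTypeR R := t + k.
have mphi : measurable_fun setT phi by exact: measurable_addr_cst.
have phiD : phi @^-1` `[k, k + 1[ = `[0, 1[%classic.
  by apply/seteqP; split=> t /=; rewrite !in_itv/= /phi => /andP[? ?]; apply/andP; split; lra.
have mD : measurable (`[k, k + 1[%classic : set R) by exact: measurable_itv.
have mgE : measurable_fun setT (EFin \o g) by exact/measurable_EFinP.
have ig' : leb.-integrable (phi @^-1` `[k, k + 1[) ((EFin \o g) \o phi).
  by rewrite phiD.
have tr (h : R -> \bar R) : (\int[pushforward leb phi]_(t in `[k, (k + 1)%R[) h t =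
    \int[leb]_(t in `[k, (k + 1)%R[) h t)%E.
  apply: eq_measure_integral => A mA _.
  exact: lebesgue_measure_translation.
split.
  have /integrableP[_ fin] := integrable_pushforward mphi mgE ig' mD.
  apply/integrableP; split; first exact: measurable_funTS.
  by move: fin; rewrite tr.
rewrite /Rintegral -tr; congr fine.
have := integral_pushforward mphi mgE ig' mD.
by rewrite phiD => <-.
Qed.

End time_averages.

Section time_averages.
Context {R : realType}.
Local Notation leb := (@lebesgue_measure R).

(** Reduces real times to integers: the part after the last integer is bounded by [b n], which is
    [o(n)], and the ratio of the integer part to [tau] tends to 1. *)
Lemma cvg_trunc_average (F : R -> R) (a b : nat -> R) (L : R) :
  cesaro a @ \oo --> L -> (fun n => n%:R^-1 * b n) @ \oo --> (0 : R) ->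
  (forall tau, 1 <= tau ->
    `|F tau - \sum_(k < Num.trunc tau) a k| <= b (Num.trunc tau)) ->
  tau^-1 * F tau @[tau --> +oo] --> L.
Proof.
move=> aL b0 Fa.
have ge1 : \forall tau \near +oo, (1 : R) <= tau by exact: nbhs_pinfty_ge.
have tr : (fun tau : R => Num.trunc tau) @ +oo --> \oo.
  apply/cvgnyPge => A; near=> tau.
  have A1 : A%:R <= tau by near: tau; exact: nbhs_pinfty_ge.
  by rewrite truncn_ge_nat// (le_trans _ A1).
have c1 : cesaro a (Num.trunc tau) @[tau --> +oo] --> L := cvg_comp _ _ tr aL.
have c3 : (Num.trunc tau)%:R^-1 * b (Num.trunc tau) @[tau --> +oo] --> 0 :=
  cvg_comp _ _ tr b0.
have c2 : (Num.trunc tau)%:R / tau @[tau --> +oo] --> (1 : R).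
  apply/cvgrPdist_le => e e0; near=> tau.
  have t1 : 1 <= tau by near: tau; exact: ge1.
  have te : e^-1 <= tau by near: tau; apply: nbhs_pinfty_ge; exact: num_real.
  have /truncn_itv /andP[h1 h2] : 0 <= tau by lra.
  rewrite (_ : 1 - _ / tau = (tau - (Num.trunc tau)%:R) / tau); last by field; lra.
  rewrite normrM [X in _ * X]ger0_norm ?invr_ge0; last lra.
  rewrite ler_pdivrMr; last lra.
  rewrite ger0_norm ?subr_ge0//.
  move: h2; rewrite -natr1 => h2.
  apply: (@le_trans _ _ 1); first lra.
  by rewrite -ler_pdivrMl// mulr1.
have c4 : tau^-1 * (F tau - \sum_(k < Num.trunc tau) a k) @[tau --> +oo] --> (0 : R).
  apply/cvgrPdist_le => e e0; near=> tau.
  have t1 : 1 <= tau by near: tau; exact: ge1.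
  have : `|0 - (Num.trunc tau)%:R^-1 * b (Num.trunc tau)| <= e.
    by near: tau; move/cvgrPdist_le : c3; exact.
  rewrite !sub0r !normrN => /(le_trans _); apply.
  have /truncn_itv /andP[h1 _] : 0 <= tau by lra.
  have n0 : 0 < (Num.trunc tau)%:R :> R by rewrite ltr0n truncn_gt0.
  have b_ge0 := le_trans (normr_ge0 _) (Fa _ t1).
  rewrite !normrM ler_pM// ?(le_trans (Fa _ t1))// ?ler_norm//.
  by rewrite !ger0_norm ?invr_ge0 ?ler_pV2 ?inE ?unitfE//; lra.
have : (Num.trunc tau)%:R / tau * cesaro a (Num.trunc tau) +
    tau^-1 * (F tau - \sum_(k < Num.trunc tau) a k) @[tau --> +oo] --> 1 * L + 0.
  by apply: cvgD => //; exact: cvgM.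
rewrite mul1r addr0; apply: cvg_trans; apply: near_eq_cvg; near=> tau.
have t1 : 1 <= tau by near: tau; exact: ge1.
have n0 : 0 < (Num.trunc tau)%:R :> R by rewrite ltr0n truncn_gt0.
rewrite /cesaro; set A := \sum_(k < _) _; set n := (Num.trunc tau)%:R in n0 *.
by field; apply/andP; split; lra.
Unshelve. all: by end_near. Qed.

Variable u : R -> R.
Hypothesis measurable_u : measurable_fun setT u.
Hypothesis iu : forall k : nat,
  leb.-integrable `[0, 1[ (EFin \o (fun t => u (t + k%:R))).

Let mulcos (g : R -> R) : continuous g -> measurable_fun setT (fun t => u t * cos (g t)).
Proof.
move=> cg; apply: measurable_funM => //; apply: continuous_measurable_fun => t.
by apply: (@continuous_cvg R R R (nbhs t) _ g cos _); [exact: continuous_cos|exact: cg].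
Qed.

Let integrable_mulcos D (h g : R -> R) : measurable D ->
  leb.-integrable D (EFin \o h) -> measurable_fun setT g ->
  leb.-integrable D (EFin \o (fun t => h t * cos (g t))).
Proof.
move=> mD ih mg; apply: (le_integrable mD _ _ ih).
  apply/measurable_EFinP; apply: measurable_funM.
    by apply/measurable_EFinP; exact: measurable_int ih.
  apply: measurable_funTS; apply: measurableT_comp => //.
  exact: (continuous_measurable_fun (@continuous_cos R)).
move=> t _; rewrite lee_fin normrM -[leRHS]mulr1.
by rewrite ler_wpM2l// norm_cos_le1.
Qed.

Lemma integrable_prefix n : leb.-integrable `[0, n%:R[ (EFin \o u).
Proof.
elim: n => [|n IH]; first by rewrite set_itvco0; exact: integrable_set0.
rewrite (_ : `[0, n.+1%:R[%classic = `[0, n%:R[%classic `|` `[n%:R, n%:R + 1[%classic).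
  apply: integrable_setU_disjoint => //.
    apply/disj_setPS => t [] /=; rewrite !in_itv/= => /andP[? ?] /andP[? ?]; lra.
  by have [] := integrable_translation measurable_u (iu n).
have n0 : 0 <= n%:R :> R by [].
apply/seteqP; split=> t /=; rewrite !in_itv/= -natr1.
  by move=> /andP[? ?]; case: (ltP t n%:R) => ?; [left|right]; apply/andP; split.
by case=> /andP[? ?]; apply/andP; split; lra.
Qed.

Lemma integrable_segment tau : leb.-integrable `[0, tau] (EFin \o u).
Proof.
apply: (integrableS _ _ _ (integrable_prefix (Num.trunc tau).+1)) => //.
move=> t /=; rewrite !in_itv/= => /andP[-> t1].
by rewrite (le_lt_trans t1)// truncnS_gt.
Qed.

Lemma Rintegral_prefix (v : R -> R) n : measurable_fun setT v ->
  (forall k : nat, leb.-integrable `[0, 1[ (EFin \o (fun t => v (t + k%:R)))) ->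
  leb.-integrable `[0, n%:R[ (EFin \o v) ->
  \int[leb]_(t in `[0, n%:R[) v t =
    \sum_(k < n) \int[leb]_(t in `[0, 1[) v (t + k%:R).
Proof.
move=> mv iv; elim: n => [|n IH] ivn.
  by rewrite set_itvco0 Rintegral_set0 big_ord0.
have n0 : 0 <= n%:R :> R by [].
have E : `[0, n.+1%:R[%classic = `[0, n%:R[%classic `|` `[n%:R, n%:R + 1[%classic :> set R.
  apply/seteqP; split=> t /=; rewrite !in_itv/= -natr1.
    by move=> /andP[? ?]; case: (ltP t n%:R) => ?; [left|right]; apply/andP; split.
  by case=> /andP[? ?]; apply/andP; split; lra.
rewrite big_ord_recr/= -(integrable_translation mv (iv n)).2 -IH; last first.
  apply: (integrableS _ _ _ ivn) => // t /=; rewrite !in_itv/= -natr1.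
  by move=> /andP[-> ?]; lra.
rewrite E in ivn *; rewrite Rintegral_setU//.
by apply/disj_setPS => t [] /=; rewrite !in_itv/= => /andP[? ?] /andP[? ?]; lra.
Qed.


Let Fabs (k : nat) := \int[leb]_(t in `[0, 1[) `|u (t + k%:R)|.

Let iabs (k : nat) : leb.-integrable `[0, 1[ (EFin \o (fun t => `|u (t + k%:R)|)).
Proof. exact: (integrable_norm (iu k)). Qed.

(** It bounds the error made by changing the frequency, and makes the last, incomplete block
    negligible. *)
Hypothesis cvg_Fabs : cvgn (cesaro Fabs).

Let Fabs_small : (fun n => n%:R^-1 * Fabs n) @ \oo --> (0 : R).
Proof.
have /cvg_ex [l cl] := cvg_Fabs.
have c1 : (fun n => cesaro Fabs (n + 1)%N) @ \oo --> l by rewrite (cvg_shiftn 1 (cesaro Fabs)).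
have c2 : (fun n : nat => 1 + n.+1%:R^-1 : R) @ \oo --> (1 + 0 : R).
  by apply: cvgD; [exact: cvg_cst|exact: cvg_harmonic].
(* A term divided by its index is the difference of two consecutive averages, the first scaled by
   [(n + 2) / (n + 1)]; indices start at 1 so that no denominator vanishes. *)
have c3 : (fun n => cesaro Fabs (n + 1 + 1)%N * (1 + n.+1%:R^-1) - cesaro Fabs (n + 1)%N) @ \oo
    --> l * (1 + 0) - l.
  apply: cvgB => //; apply: cvgM => //.
  by rewrite (cvg_shiftn 1 (fun n => cesaro Fabs (n + 1)%N)).
rewrite -(cvg_shiftn 1); move: c3; rewrite addr0 mulr1 subrr; apply: cvg_trans.
apply: near_eq_cvg; apply: nearW => n.
rewrite /= !addn1 /cesaro [in LHS]big_ord_recr/=.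
rewrite -(natr1 n.+1); set s := \sum_(k < n.+1) _.
have n0 : 0 < n.+1%:R :> R by rewrite ltr0n.
by move: n0; set x := n.+1%:R => x0; field; apply/andP; split; lra.
Qed.

(** With time written [t + k], [t] in [[0, 1[], the phase is [2 * pi * theta * t] plus a term in
    [k]. Only in the first is [theta] replaced by a rational, at an error proportional to the
    distance of the frequencies. The term in [k] keeps [theta], as the hypothesis covers all
    frequencies there. *)
Lemma time_average_cvg theta alpha :
  (forall (q : rat) (b : bool) theta alpha, cvgn (cesaro (fun k =>
     (\int[leb]_(t in `[0, 1[)
       (u (t + k%:R) * cos (2 * pi * ratr q * t + b%:R * - (pi / 2)))) *
     cos (k%:R * theta + alpha)))) ->
  exists l : R, tau^-1 * (\int[leb]_(t in `[0, tau])
    (u t * cos (2 * pi * theta * t + alpha))) @[tau --> +oo] --> l.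
Proof.
move=> Hq; pose g t := 2 * pi * theta * t + alpha.
have cg : continuous g.
  by move=> t; apply: cvgD; [apply: cvgMr; exact: cvg_id|exact: cvg_cst].
pose v t := u t * cos (g t).
have mv : measurable_fun setT v by exact: mulcos.
have mg : measurable_fun setT g by exact: continuous_measurable_fun.
have mD : measurable (`[0, 1[%classic : set (measurableTypeR R)) by exact: measurable_itv.
have iv (k : nat) : leb.-integrable `[0, 1[ (EFin \o (fun t => v (t + k%:R))).
  apply: (integrable_mulcos (h := fun t => u (t + k%:R)) (g := fun t => g (t + k%:R))) => //.
  by apply: (measurableT_comp mg); exact: measurable_addr_cst.
have ivn n : leb.-integrable `[0, n%:R[ (EFin \o v).
  by apply: integrable_mulcos => //; exact: integrable_prefix.
pose a (k : nat) := \int[leb]_(t in `[0, 1[) v (t + k%:R).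
have [C C0 FC] : exists2 C : R, 0 < C & forall n, cesaro Fabs n <= C.
  have [C [_ hC]] := cvg_seq_bounded cvg_Fabs.
  exists (`|C| + 1); first by rewrite ltr_wpDl.
  by move=> n; apply: le_trans (ler_norm _) _; apply: (hC _ _ n I); have := ler_norm C; lra.
have [L aL] : exists L : R, cesaro a @ \oo --> L.
  apply/cvg_ex; apply: is_cvg_uniform_approx => e e0.
  have pi0 : 0 < pi :> R by exact: pi_gt0.
  (* This precision keeps the mean error, [2 * pi * (q - theta)] times [C], below [e]. *)
  have [q] := @rat_in_itvoo R theta (theta + e / (2 * pi * C)) ltac:(
    rewrite ltrDl divr_gt0// mulr_gt0// mulr_gt0//).
  rewrite in_itv/= => /andP[q1 q2].
  pose b (k : nat) := \int[leb]_(t in `[0, 1[)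
    (u (t + k%:R) * cos (2 * pi * ratr q * t + (k%:R * (2 * pi * theta) + alpha))).
  have ib (k : nat) beta : leb.-integrable `[0, 1[
      (EFin \o (fun t => u (t + k%:R) * cos (2 * pi * ratr q * t + beta))).
    apply: (integrable_mulcos (h := fun t => u (t + k%:R))) => //.
    by apply: measurable_funD => //; exact: measurable_funM.
  pose I0 k := \int[leb]_(t in `[0, 1[) (u (t + k%:R) * cos (2 * pi * ratr q * t + 0)).
  pose I1 k := \int[leb]_(t in `[0, 1[)
    (u (t + k%:R) * cos (2 * pi * ratr q * t + - (pi / 2))).
  pose y1 := alpha - pi / 2.
  (* The addition formula separates the phase in [t] from the phase in [k]. *)
  have bE k : b k = I0 k * cos (k%:R * (2 * pi * theta) + alpha) -
      I1 k * cos (k%:R * (2 * pi * theta) + y1).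
    rewrite -RintegralZr// -RintegralZr// -RintegralB//; last 2 first.
    - by apply: integrable_mulcos => //; exact: ib.
    - by apply: integrable_mulcos => //; exact: ib.
    apply: eq_Rintegral => t _.
    rewrite addr0 [_ + (alpha - _)]addrA !cosBpihalf [in LHS]cosD; ring.
  exists (cesaro b).
    have /cvg_ex [l0] := Hq q false (2 * pi * theta) alpha; rewrite mul0r => c0.
    have /cvg_ex [l1] := Hq q true (2 * pi * theta) y1; rewrite mul1r => c1.
    apply/cvg_ex; exists (l0 - l1).
    rewrite (_ : cesaro b = fun n =>
      cesaro (fun k => I0 k * cos (k%:R * (2 * pi * theta) + alpha)) n -
      cesaro (fun k => I1 k * cos (k%:R * (2 * pi * theta) + y1)) n).
      exact: cvgB.
    by apply/funext => n; rewrite -cesaroB; congr cesaro; apply/funext => k.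
  move=> n; rewrite -cesaroB; apply: le_trans (le_normr_cesaro _ _) _.
  pose D := 2 * pi * (ratr q - theta).
  have D0 : 0 <= D by rewrite mulr_ge0 ?mulr_ge0 ?ltW// subr_gt0.
  apply: (@le_trans _ _ (cesaro (fun k => D * Fabs k) n)); last first.
    rewrite cesaroZl; apply: le_trans (ler_wpM2l D0 (FC n)) _.
    rewrite /D mulrAC -ler_pdivlMl ?mulr_gt0//.
    by rewrite mulrC; move: q2; lra.
  apply: le_cesaro => k; rewrite /a /b -RintegralB//.
  have iB : leb.-integrable `[0, 1[ (EFin \o (fun t => v (t + k%:R) -
      u (t + k%:R) * cos (2 * pi * ratr q * t + (k%:R * (2 * pi * theta) + alpha)))).
    by apply: (eq_integrable mD _ _ _ (integrableB mD (iv k) (ib k _))).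
  apply: le_trans (le_normr_Rintegral _ _) _ => //.
  rewrite /Fabs -RintegralZl//; apply: le_Rintegral => //.
  - by apply: integrable_norm; exact: iB.
  - exact: (integrableZl mD D (iabs k)).
  move=> t; rewrite /= in_itv/= => /andP[t0 t1].
  rewrite /v /g -mulrBr normrM mulrC ler_wpM2r//.
  apply: le_trans (ler_dist_cos _ _) _.
  rewrite (_ : _ - _ = - (D * t)); last by rewrite /D; ring.
  rewrite normrN normrM (ger0_norm D0) (ger0_norm t0).
  by rewrite -[leRHS]mulr1 ler_wpM2l// ltW.
exists L; apply: (cvg_trunc_average aL Fabs_small) => tau tau1.
have /truncn_itv /andP[h1 h2] : 0 <= tau by lra.
set n := Num.trunc tau in h1 h2 *.
have n0 : 0 <= n%:R :> R by [].
rewrite -(Rintegral_prefix mv iv (ivn n)).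
have itau : leb.-integrable `[0, tau] (EFin \o v).
  by apply: integrable_mulcos => //; exact: integrable_segment.
have E : `[0, tau]%classic = `[0, n%:R[%classic `|` `[n%:R, tau]%classic :> set R.
  apply/seteqP; split=> t /=; rewrite !in_itv/=.
    by move=> /andP[? ?]; case: (ltP t n%:R) => ?; [left|right]; apply/andP; split.
  by case=> /andP[? ?]; apply/andP; split; lra.
have -> : \int[leb]_(t in `[0, tau]) v t =
    \int[leb]_(t in `[0, n%:R[) v t + \int[leb]_(t in `[n%:R, tau]) v t.
  rewrite E in itau *; rewrite Rintegral_setU//.
  by apply/disj_setPS => t [] /=; rewrite !in_itv/= => /andP[? ?] /andP[? ?]; lra.
rewrite addrC addKr.
have mE : measurable (`[n%:R, tau]%classic : set (measurableTypeR R)) by exact: measurable_itv.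
have mE1 : measurable (`[n%:R, n%:R + 1[%classic : set (measurableTypeR R)).
  exact: measurable_itv.
have in1 : leb.-integrable `[n%:R, n%:R + 1[ (EFin \o u).
  by have [] := integrable_translation measurable_u (iu n).
have subE : (`[n%:R, tau]%classic : set R) `<=` `[n%:R, n%:R + 1[%classic.
  by move=> t /=; rewrite !in_itv/= => /andP[-> ?]; move: h2; rewrite -natr1 => ?; lra.
have inE : leb.-integrable `[n%:R, tau] (EFin \o u) by exact: (integrableS mE1 mE subE in1).
have ivE : leb.-integrable `[n%:R, tau] (EFin \o v) by exact: integrable_mulcos.
apply: le_trans (le_normr_Rintegral _ _) _ => //.
apply: (@le_trans _ _ (\int[leb]_(t in `[n%:R, tau]) `|u t|)).
  apply: le_Rintegral => //; [exact: integrable_norm|exact: integrable_norm|].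
  by move=> t _; rewrite normrM -[leRHS]mulr1 ler_wpM2l// norm_cos_le1.
have mau : measurable_fun setT (fun t => `|u t|) by exact: measurableT_comp.
rewrite /Fabs -(integrable_translation mau (iabs n)).2.
apply: fine_le.
- exact: integrable_fin_num (integrable_norm inE).
- exact: integrable_fin_num (integrable_norm in1).
- apply: ge0_subset_integral => //.
  by apply: measurable_funTS; exact/measurable_EFinP.
Qed.

End time_averages.

(** * Completions *)

(** Each set [u < q] with [q] rational is measurable up to a null set, and these sets determine [u].
    Off the union [Z] of the null sets [u] is kept; on [Z] it is replaced by 0. *)
Lemma measurable_version (R : realType) d (X : measurableType d)
    (m : {measure set X -> \bar R}) (u : X -> R) :
  (forall B : set R, measurable B -> completed_algebra_gen m (u @^-1` B)) ->
  exists (v : X -> R) (Z : set X), [/\ measurable_fun setT v, measurable Z,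
    m Z = 0%E & forall x, ~ Z x -> u x = v x].
Proof.
move=> cu.
have H (n : nat) : exists AZ : set X * set X,
  [/\ measurable AZ.1, measurable AZ.2, m AZ.2 = 0%E &
    forall q : rat, unpickle n = Some q -> forall x, ~ AZ.2 x -> (AZ.1 x <-> u x < ratr q)].
  case: (unpickle n : option rat) => [q|]; last first.
    by exists (set0, set0); split => //=; exact: measure0.
  have [A mA [N [Z [mZ Z0 NZ]] AN]] := cu `]-oo, ratr q[%classic (measurable_itv _).
  exists (A, Z); split=> // _ [<-] x nZ /=.
  have xE : (u @^-1` `]-oo, ratr q[) x <-> u x < ratr q by rewrite /= in_itv.
  rewrite -xE -AN; split; [by left|case=> // Nx].
  by exfalso; apply: nZ; exact: NZ.
have [AZ hAZ] := choice H.
pose Z := \bigcup_n (AZ n).2.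
have mZ : measurable Z by apply: bigcupT_measurable => n; have [] := hAZ n.
have Z0 : m Z = 0%E.
  apply/(negligibleP m mZ)/negligible_bigcup => n.
  by have [_ mn n0 _] := hAZ n; apply/negligibleP.
exists (fun x => if x \in Z then 0 else u x), Z; split=> //; last first.
  by move=> x nZ; rewrite memNset.
move=> _; apply: (measurability _ (RGenInftyO.measurableE R)) => // _ [_ [c ->] <-].
rewrite setTI.
have mc : measurable (\bigcup_(q : rat) (if ratr q <= c then
    (AZ (pickle q)).1 `&` ~` Z else set0)).
  apply: countable_bigcupT_measurable => [|q]; first exact: countableP.
  case: ifP => // _; apply: measurableI; last exact: measurableC.
  by have [] := hAZ (pickle q).
(* On [Z] the version is 0, which is below [c] exactly when [0 < c]. *)
have m0 : measurable (if 0 < c then Z else set0) by case: ifP.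
rewrite (_ : _ @^-1` _ = \bigcup_(q : rat) (if ratr q <= c then
    (AZ (pickle q)).1 `&` ~` Z else set0) `|` (if 0 < c then Z else set0)).
  exact: measurableU.
apply/seteqP; split=> x /=; rewrite in_itv/=.
  have [xZ|xZ] := boolP (x \in Z).
    by move=> c0; right; rewrite c0; exact: set_mem.
  move=> /rat_in_itvoo [q]; rewrite in_itv/= => /andP[uq qc].
  have nZ : ~ Z x by move: xZ; rewrite notin_setE.
  left; exists q => //; rewrite ltW//; split=> //.
  have [_ _ _ h] := hAZ (pickle q); apply/(h q (pickleK _) x) => //.
  by move=> Zx; apply: nZ; exists (pickle q).
case=> [[q _]|]; last by case: ifPn => // c0 Zx; rewrite mem_set.
case: ifPn => // qc [Ax nZ]; rewrite memNset//.
have [_ _ _ h] := hAZ (pickle q).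
apply: lt_le_trans qc; apply/(h q (pickleK _) x) => //.
by move=> Zx; apply: nZ; exists (pickle q).
Qed.

Section completed_lebesgue.
Context {R : realType}.
Local Notation leb := (@lebesgue_measure R).
Local Notation cleb := (@completed_lebesgue_measure R).
Local Notation cR := (caratheodory_type (wlength (@idfun R))^*%mu).

(** The identity from the completed line to the Borel line pushes the completed measure to [leb];
    completeness then absorbs the null set [Z] where [g] may differ from [u]. *)
Lemma completed_lebesgue_transfer (D Z : set R) (g u : R -> R) :
  measurable (D : set (measurableTypeR R)) ->
  measurable (Z : set (measurableTypeR R)) -> leb Z = 0%E ->
  measurable_fun setT u -> leb.-integrable D (EFin \o u) ->
  (forall t, ~ Z t -> g t = u t) ->
  cleb.-integrable D (EFin \o g) /\ Rintegral cleb D g = Rintegral leb D u.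
Proof.
move=> mD mZ Z0 meas_u iu gu.
pose phi (t : cR) : measurableTypeR R := t.
have mphi : measurable_fun setT phi.
  by move=> _ A mA; rewrite setTI; exact: sub_caratheodory.
have muE : measurable_fun setT (EFin \o u) by exact/measurable_EFinP.
have mDc : measurable (D : set (cR)).
  exact: sub_caratheodory.
have mZc : measurable (Z : set (cR)).
  exact: sub_caratheodory.
have tr (h : measurableTypeR R -> \bar R) :
    (\int[pushforward cleb phi]_(x in D) h x = \int[leb]_(x in D) h x)%E.
  by apply: eq_measure_integral => // A mA _.
have mucT : measurable_fun [set: cR] ((EFin \o u) \o phi) by exact: measurableT_comp muE mphi.
have muc : measurable_fun (D : set cR) ((EFin \o u) \o phi) by exact: measurable_funTS.
have iuc : cleb.-integrable D ((EFin \o u) \o phi).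
  apply/integrableP; split; first exact: muc.
  have /integrableP[_] := iu; rewrite -tr ge0_integral_pushforward//.
  by apply: measurable_funTS; exact: measurableT_comp.
have aeq : ae_eq cleb D ((EFin \o u) \o phi) (EFin \o g).
  exists Z; split=> //.
  move=> t /= h; apply: contrapT => nZ; apply: h => _.
  by rewrite /phi/= gu.
have mgc : measurable_fun (D : set cR) (EFin \o g : cR -> \bar R).
  exact: (ae_measurable_fun (@completed_lebesgue_measure_is_complete R) aeq muc).
split.
  apply/integrableP; split=> //.
  have /integrableP[_] := iuc; congr (_ < _)%E.
  apply: ae_eq_integral; [exact: mDc|exact: measurableT_comp|exact: measurableT_comp|].
  exact: ae_eq_abse.
rewrite /Rintegral; congr fine.
rewrite -tr integral_pushforward//.
apply: ae_eq_integral; [exact: mDc|exact: mgc|exact: muc|exact: ae_eq_sym].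
Qed.

End completed_lebesgue.

(** * Flows *)

Section ae_ysection.
Context {R : realType} d1 d2 {X : measurableType d1} {Y : measurableType d2}.
Variables (m1 : {sigma_finite_measure set X -> \bar R})
  (m2 : {sigma_finite_measure set Y -> \bar R}).

(** The product measure integrates the other sections, so this side goes through Tonelli. *)
Lemma ae_ysection0 (N : set (X * Y)) : measurable N -> (m1 \x m2)%E N = 0%E ->
  {ae m2, forall y, m1 (ysection N y) = 0%E}.
Proof.
move=> mN N0.
have mpsi := measurable_fun_ysection m1 mN.
have : (\int[m2]_y `|(m1 \o ysection N) y| = 0)%E.
  transitivity (\int[(m1 \x m2)%E]_z (EFin \o \1_N) z)%E; last by
    rewrite integral_indic// setIT.
  rewrite (fubini_tonelli2 (EFin \o \1_N)) /=; last 2 first.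
  - exact/measurable_EFinP/measurable_indicP.
  - by move=> x; rewrite lee_fin.
  rewrite indic_fubini_tonelli_GE//.
  by apply: eq_integral => y _; rewrite gee0_abs.
move/(ae_eq_integral_abs m2 measurableT mpsi).
by apply: filterS => y /(_ I).
Qed.

End ae_ysection.

Lemma integrable_ae_eq (R : realType) d (X : measurableType d)
    (mu : {measure set X -> \bar R}) (D : set X) (g h : X -> R) :
  measurable D -> measurable_fun setT h ->
  (exists N, [/\ measurable N, mu N = 0%E & forall x, ~ N x -> g x = h x]) ->
  mu.-integrable D (EFin \o g) ->
  mu.-integrable D (EFin \o h) /\ \int[mu]_(x in D) g x = \int[mu]_(x in D) h x.
Proof.
move=> mD mh [N [mN N0 gh]] ig.
have /integrableP[mg fin] := ig.
have mhD : measurable_fun D (EFin \o h) by apply: measurable_funTS; exact/measurable_EFinP.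
have aeq : ae_eq mu D (EFin \o g) (EFin \o h).
  exists N; split=> // x /= nP; apply: contrapT => nN; apply: nP => _.
  by rewrite /= gh.
split; last by rewrite /Rintegral; congr fine; exact: ae_eq_integral.
apply/integrableP; split=> //; move: fin; congr (_ < _)%E.
by apply: ae_eq_integral => //;
  [exact: measurableT_comp|exact: measurableT_comp|exact: ae_eq_abse].
Qed.

Section flow.
Context {R : realType} d {Omega : measurableType d}.
Variables (mu : probability Omega R) (T : R -> Omega -> Omega).
Hypothesis hmeas : jointly_measurable mu T.
Hypothesis hmp : forall t : R, measure_preserving mu (T t).
Hypothesis hflow : forall t s : R, T t \o T s = T (t + s).
Local Notation leb := (@lebesgue_measure R).

Lemma flow_iter t k w : T t (iter k (T 1) w) = T (t + k%:R) w.
Proof.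
elim: k t => [|k IH] t; first by rewrite addr0.
by rewrite iterS -[LHS]/((T t \o T 1) _) hflow IH -(natr1 k) [k%:R + 1]addrC addrA.
Qed.

Variable f : Omega -> R.
Hypothesis intf : mu.-integrable setT (EFin \o f).

Lemma flow_version : exists (v : measurableTypeR R * Omega -> R)
    (Z : set (measurableTypeR R * Omega)),
  [/\ measurable_fun setT v, measurable Z, (leb \x mu)%E Z = 0%E &
      forall t w, ~ Z (t, w) -> f (T t w) = v (t, w)].
Proof.
have mf : measurable_fun setT f by apply/measurable_EFinP; exact: measurable_int intf.
have [|v [Z [mv mZ Z0 fv]]] := @measurable_version R _ _ (leb \x mu)%E
    (fun p : measurableTypeR R * Omega => f (T p.1 p.2)).
  move=> B mB; apply: (hmeas (A := f @^-1` B)).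
  by rewrite -[X in measurable X]setTI; exact: mf.
by exists v, Z; split=> // t w /fv.
Qed.

Section version.
Variables (v : measurableTypeR R * Omega -> R) (Z : set (measurableTypeR R * Omega)).
Hypotheses (mv : measurable_fun setT v) (mZ : measurable Z)
  (Z0 : (leb \x mu)%E Z = 0%E) (fv : forall t w, ~ Z (t, w) -> f (T t w) = v (t, w)).

(** Time is cut to one unit, since [v] is in general not integrable over all times. *)
Let strip (psi : measurableTypeR R * Omega -> R) p := psi p * \1_(`[0, 1[%classic : set R) p.1.

Let measurable_strip psi : measurable_fun setT psi -> measurable_fun setT (strip psi).
Proof.
move=> mpsi; apply: measurable_funM => //.
apply: (measurableT_comp _ measurable_fst).
by apply/measurable_indicP; exact: measurable_itv.
Qed.

(** For almost every [t] the slice of [v] agrees almost everywhere with [f \o T t], whose norm is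
    that of [f]; conclude by Tonelli over unit time. *)
Let integrable_strip_v : (leb \x mu)%E.-integrable setT (EFin \o strip v).
Proof.
have mE : measurable_fun setT (EFin \o strip v).
  by apply/measurable_EFinP; exact: measurable_strip.
apply/integrable12ltyP => //.
have [mf If] := integrableP _ _ _ intf.
have aeq : {ae leb, forall t, (\int[mu]_w `|(EFin \o strip v) (t, w)| =
    (\int[mu]_w `|(EFin \o f) w|) * (\1_(`[0%R, 1%R[%classic : set R) t)%:E)%E}.
  apply: filterS (ae_xsection0 mZ Z0) => t Zt.
  rewrite -(@ge0_integral_invariant _ _ _ mu (T t) _ (abse \o (EFin \o f)))//; first last.
    by move=> w; exact: abse_ge0.
    exact: measurableT_comp.
    exact: hmp.
  have mfT : measurable_fun setT (fun w => `|(EFin \o f) (T t w)|%E).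
    by apply: measurableT_comp => //; exact: measurableT_comp mf (hmp t).1.
  rewrite -ge0_integralZr//; last by move=> w _; exact: abse_ge0.
  apply: ae_eq_integral => //.
  - by apply: measurableT_comp => //; exact: (measurableT_comp mE (pair1_measurable t)).
  - exact: emeasurable_funM.
  exists (xsection Z t); split; [exact: measurable_xsection|exact: Zt|].
  move=> w /= nP; rewrite /xsection/= inE; apply: contrapT => nZ; apply: nP => _.
  by rewrite /strip/= -fv// normrM EFinM [X in (_ * X%:E)%E]ger0_norm.
pose K := (\int[mu]_w `|(EFin \o f) w|)%E.
have K0 : (0 <= K)%E by exact: integral_ge0.
apply: (@le_lt_trans _ _ (\int[leb]_t (K * (\1_(`[0%R, 1%R[%classic : set R) t)%:E))%E).
  apply: ae_ge0_le_integral => //.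
  - by move=> t _; exact: integral_ge0.
  - apply: (measurable_fun_fubini_tonelli_F (abse \o (EFin \o strip v))) => //.
      exact: measurableT_comp.
    by move=> p; exact: abse_ge0.
  - by move=> t _; rewrite mule_ge0.
  - apply: emeasurable_funM => //; apply/measurable_EFinP/measurable_indicP.
    exact: measurable_itv.
  - by apply: filterS aeq => t -> _.
rewrite ge0_integralZl//; last first.
  by apply/measurable_EFinP/measurable_indicP; exact: measurable_itv.
rewrite integral_indic//= ?setIT ?lebesgue_measure_itv/= ?lte_fin ?ltr01.
by rewrite oppr0 adde0 mule1.
Qed.

(** Domination by [v] covers both its absolute value and its modulations by rational frequencies. *)
Lemma integrable_strip_average (psi : measurableTypeR R * Omega -> R) :
  measurable_fun setT psi -> (forall p, `|psi p| <= `|v p|) ->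
  mu.-integrable setT (EFin \o (fun w => \int[leb]_(t in `[0, 1[) psi (t, w))).
Proof.
move=> mpsi psiv.
have istrip : (leb \x mu)%E.-integrable setT (EFin \o strip psi).
  apply: (le_integrable measurableT _ _ integrable_strip_v).
    by apply/measurable_EFinP; exact: measurable_strip.
  by move=> p _; rewrite lee_fin /strip !normrM ler_wpM2r.
have mstrip := measurable_int _ istrip.
have mG := measurable_fubini_G istrip.
have iG : mu.-integrable setT (fubini_G leb (EFin \o strip psi)).
  apply/integrableP; split; first exact: mG.
  have fin := (integrable21ltyP leb mu mstrip).1 istrip.
  apply: (le_lt_trans _ fin).
  apply: ge0_le_integral => //.
  - exact: measurableT_comp.
  - apply: (measurable_fun_fubini_tonelli_G (abse \o (EFin \o strip psi))).
      exact: measurableT_comp.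
    by move=> p; exact: abse_ge0.
  - move=> w _; apply: le_abse_integral => //.
    exact: measurableT_comp mstrip (pair2_measurable w).
have E : EFin \o (fun w => \int[leb]_(t in `[0, 1[) psi (t, w)) =
    EFin \o (fine \o fubini_G leb (EFin \o strip psi)).
  apply/funext => w /=; rewrite Rintegral_mkcond patch_indic.
  by rewrite /Rintegral /fubini_G.
rewrite E; apply: (le_integrable measurableT _ _ iG).
  apply/measurable_EFinP; apply: measurableT_comp => //.
(* Where the inner integral is infinite, [fine] gives 0, which is still dominated. *)
move=> w _; rewrite [in leLHS]/comp.
by case: (fubini_G leb _ w) => [r||] /=; rewrite ?normr0 ?lexx ?leey.
Qed.

Lemma ae_integrable_fiber :
  {ae mu, forall w, leb.-integrable `[0, 1[ (EFin \o (fun t => v (t, w)))}.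
Proof.
apply: filterS (ae_integrable2 integrable_strip_v) => w iw.
apply/integrable_mkcond; first exact: measurable_itv.
apply: eq_integrable iw => // t _; rewrite restrict_EFin/= patch_indic.
by [].
Qed.

End version.

(** The discrete theorem concerns [v] over the points [iter k (T 1) w], the time average concerns
    the fibre [u] over [w] alone. The flow property makes them agree, after a shift by [k], for
    almost every [t]. *)
Theorem wiener_wintner_flow : {ae mu, forall w,
  forall theta alpha : R,
  (forall tau : R, (@completed_lebesgue_measure R).-integrable `[0, tau]
     (EFin \o (fun t => f (T t w) * cos (2 * pi * theta * t + alpha)))) /\
  exists l : R, tau^-1 * Rintegral (@completed_lebesgue_measure R) `[0, tau]%classic
     (fun t => f (T t w) * cos (2 * pi * theta * t + alpha)) @[tau --> +oo] --> l}.
Proof.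
have [v [Z [mv mZ Z0 fv]]] := flow_version.
have Smu : invariant_measure mu (T 1) := hmp 1.
have mcosg (a b : R) : measurable_fun setT (fun t : R => cos (a * t + b)).
  apply: (measurableT_comp (continuous_measurable_fun (@continuous_cos R))).
  by apply: measurable_funD => //; exact: measurable_funM.
pose Psi (q : rat) (b : bool) (p : measurableTypeR R * Omega) :=
  v p * cos (2 * pi * ratr q * p.1 + b%:R * - (pi / 2)).
have ae_abs : {ae mu, forall w, forall theta alpha, cvgn (cesaro (fun k =>
    (\int[leb]_(t in `[0, 1[) `|v (t, iter k (T 1) w)|) * cos (k%:R * theta + alpha)))}.
  apply: (wiener_wintner_integrable Smu
    (f := fun w => \int[leb]_(t in `[0, 1[) `|v (t, w)|)).
  apply: (integrable_strip_average mv mZ Z0 fv (psi := fun p => `|v p|)).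
    exact: measurableT_comp.
  by move=> p; rewrite normr_id.
have ae_Psi : {ae mu, forall w, forall n qb, unpickle n = Some qb ->
    forall theta alpha, cvgn (cesaro (fun k =>
    (\int[leb]_(t in `[0, 1[) Psi qb.1 qb.2 (t, iter k (T 1) w)) *
    cos (k%:R * theta + alpha)))}.
  apply: ae_foralln => n; case: (unpickle n) => [qb|]; last exact: aeW.
  suff : {ae mu, forall w, forall theta alpha, cvgn (cesaro (fun k =>
    (\int[leb]_(t in `[0, 1[) Psi qb.1 qb.2 (t, iter k (T 1) w)) *
    cos (k%:R * theta + alpha)))} by apply: filterS => w cvw _ [<-].
  apply: (wiener_wintner_integrable Smu
    (f := fun w => \int[leb]_(t in `[0, 1[) Psi qb.1 qb.2 (t, w))).
  apply: (integrable_strip_average mv mZ Z0 fv (psi := Psi qb.1 qb.2)).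
    apply: measurable_funM => //.
    exact: (measurableT_comp (mcosg _ _) measurable_fst).
  by move=> p; rewrite normrM -[leRHS]mulr1 ler_wpM2l// norm_cos_le1.
have ae_null := ae_iter Smu (ae_ysection0 mZ Z0).
have ae_int := ae_iter Smu (ae_integrable_fiber mv mZ Z0 fv).
have ae1 : {ae mu, forall w, (forall theta alpha, cvgn (cesaro (fun k =>
    (\int[leb]_(t in `[0, 1[) `|v (t, iter k (T 1) w)|) * cos (k%:R * theta + alpha)))) /\
    (forall k, leb (ysection Z (iter k (T 1) w)) = 0%E)}.
  by apply: filterS2 ae_abs ae_null.
have ae2 : {ae mu, forall w, (forall n qb, unpickle n = Some qb ->
    forall theta alpha, cvgn (cesaro (fun k =>
    (\int[leb]_(t in `[0, 1[) Psi qb.1 qb.2 (t, iter k (T 1) w)) *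
    cos (k%:R * theta + alpha)))) /\
    (forall k, leb.-integrable `[0, 1[ (EFin \o (fun t => v (t, iter k (T 1) w))))}.
  by apply: filterS2 ae_Psi ae_int.
apply: filterS2 ae1 ae2 => w [cabs nul] [cPsi int] theta alpha.
pose u (t : R) : R := v (t, w).
have mfiber w' : measurable_fun setT (fun t : measurableTypeR R => v (t, w')).
  exact: (measurableT_comp mv (pair2_measurable w')).
have meas_u : measurable_fun setT u by exact: mfiber.
have mD : measurable (`[0, 1[%classic : set (measurableTypeR R)) by exact: measurable_itv.
have mush (k : nat) : measurable_fun setT (fun t : measurableTypeR R => u (t + k%:R)).
  by apply: (measurableT_comp meas_u); exact: measurable_addr_cst.
(* Times at which either version may fail to be the value of [f] on the orbit. *)
pose N (k : nat) : set (measurableTypeR R) :=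
  ysection Z (iter k (T 1) w) `|` (fun t : R => t + k%:R) @^-1` (ysection Z w).
have mys w' : measurable (ysection Z w') by exact: measurable_ysection.
have mpre (k : nat) : measurable ((fun t : measurableTypeR R => t + k%:R : measurableTypeR R)
    @^-1` (ysection Z w)).
  by rewrite -[X in measurable X]setTI; exact: measurable_addr_cst.
have mN k : measurable (N k) by exact: measurableU.
have N0 k : leb (N k) = 0%E.
  apply/eqP; rewrite eq_le measure_ge0 andbT.
  apply: (le_trans (measureU2 leb (mys _) (mpre k))).
  rewrite [X in (X + _)%E](nul k) add0e.
  rewrite [leLHS](lebesgue_measure_translation k%:R (mys w)).
  by rewrite (nul 0%N).
have shiftE k t : ~ N k t -> v (t, iter k (T 1) w) = u (t + k%:R).
  move=> nN; rewrite /u -!fv ?flow_iter//.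
    by move=> ZZ; apply: nN; right; rewrite /= /ysection/= inE.
  by move=> ZZ; apply: nN; left; rewrite /ysection/= inE.
have iu k : leb.-integrable `[0, 1[ (EFin \o (fun t => u (t + k%:R))).
  apply: (integrable_ae_eq mD (mush k) _ (int k)).1.
  by exists (N k); split; [exact: mN|exact: N0|move=> t /shiftE].
have absE k : \int[leb]_(t in `[0, 1[) `|v (t, iter k (T 1) w)| =
    \int[leb]_(t in `[0, 1[) `|u (t + k%:R)|.
  apply: (integrable_ae_eq mD _ _ (integrable_norm (int k))).2.
    exact: measurableT_comp.
  by exists (N k); split; [exact: mN|exact: N0|move=> t /shiftE /= ->].
have PsiE q b k : \int[leb]_(t in `[0, 1[) Psi q b (t, iter k (T 1) w) =
    \int[leb]_(t in `[0, 1[) (u (t + k%:R) * cos (2 * pi * ratr q * t + b%:R * - (pi / 2))).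
  apply: (integrable_ae_eq mD _ _ _).2.
  - by apply: measurable_funM; [exact: mush|exact: mcosg].
  - exists (N k); split; [exact: mN|exact: N0|move=> t /shiftE h].
    by rewrite /Psi/= h.
  apply: (le_integrable mD _ _ (int k)).
    apply/measurable_EFinP/measurable_funTS; apply: measurable_funM.
      exact: mfiber.
    exact: mcosg.
  by move=> t _; rewrite lee_fin normrM -[leRHS]mulr1 ler_wpM2l// norm_cos_le1.
(* Zero frequency and zero phase give the untwisted averages. *)
have cvg_abs : cvgn (cesaro (fun k => \int[leb]_(t in `[0, 1[) `|u (t + k%:R)|)).
  rewrite (_ : (fun k => _) = fun k : nat =>
    (\int[leb]_(t in `[0, 1[) `|v (t, iter k (T 1) w)|) * cos (k%:R * 0 + 0)).
    exact: cabs.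
  by apply/funext => k; rewrite absE mulr0 addr0 cos0 mulr1.
have mE tau : measurable (`[0, tau]%classic : set (measurableTypeR R)).
  exact: measurable_itv.
have transfer (tau : R) :
    (@completed_lebesgue_measure R).-integrable `[0, tau]
     (EFin \o (fun t => f (T t w) * cos (2 * pi * theta * t + alpha))) /\
    Rintegral (@completed_lebesgue_measure R) `[0, tau]%classic
     (fun t => f (T t w) * cos (2 * pi * theta * t + alpha)) =
    \int[leb]_(t in `[0, tau]) (u t * cos (2 * pi * theta * t + alpha)).
  apply: (completed_lebesgue_transfer (mE tau) (mys w) (nul 0%N)).
  - by apply: measurable_funM; [exact: meas_u|exact: mcosg].
  - apply: (le_integrable (mE tau) _ _ (integrable_segment meas_u iu tau)).
      by apply/measurable_EFinP/measurable_funTS; apply: measurable_funM;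
        [exact: meas_u|exact: mcosg].
    by move=> t _; rewrite lee_fin normrM -[leRHS]mulr1 ler_wpM2l// norm_cos_le1.
  - move=> t nZ; rewrite fv// => ZZ; apply: nZ.
    by rewrite /ysection/= inE.
split; first by move=> tau; have [] := transfer tau.
have [|l hl] := @time_average_cvg R u meas_u iu cvg_abs theta alpha.
  move=> q b theta' alpha'.
  rewrite (_ : (fun k => _) = fun k : nat =>
      (\int[leb]_(t in `[0, 1[) Psi q b (t, iter k (T 1) w)) * cos (k%:R * theta' + alpha')).
    exact: (cPsi (pickle (q, b)) (q, b) (pickleK _)).
  by apply/funext => k; rewrite PsiE.
exists l; apply: cvg_trans hl; apply: near_eq_cvg; apply: nearW => tau.
by rewrite (transfer tau).2.
Qed.

End flow.

(** * Complex-valued functions *)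

Local Open Scope complex_scope.

Lemma cvg_complex (R : realType) (T : Type) (F : set_system T) (FF : Filter F)
    (a b : T -> R) (la lb : R) :
  a @ F --> la -> b @ F --> lb ->
  (fun x => (a x +i* b x : R[i]^o)) @ F --> (la +i* lb : R[i]^o).
Proof.
move=> ha hb; apply/cvgrPdist_le => e e0.
(* A positive complex number is real. *)
have eE : e = (complex.Re e)%:C.
  by move: e0; case: e => x y; rewrite ltcE /= => /andP[/eqP -> _].
have re0 : 0 < complex.Re e by move: e0; rewrite eE ltcR.
have e2 : 0 < complex.Re e / 2 by rewrite divr_gt0.
near=> x.
have h1 : `|la - a x| <= complex.Re e / 2.
  by near: x; move/cvgrPdist_le : ha; exact.
have h2 : `|lb - b x| <= complex.Re e / 2.
  by near: x; move/cvgrPdist_le : hb; exact.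
rewrite eE normc_def lecR /= -[leRHS]ger0_norm; last exact: ltW.
rewrite -sqrtr_sqr ler_wsqrtr//.
move: h1 h2; set x1 := la - _; set y1 := lb - _; clearbody x1 y1.
rewrite !ler_norml => /andP[? ?] /andP[? ?]; nra.
Unshelve. all: by end_near. Qed.

(** Integrability on every segment is part of the conclusion, so that the averages are those of
    genuine integrals and not of default values. *)
Theorem theorem2p3 (R : realType) (d : measure_display)
    (Omega : measurableType d) (mu : probability Omega R)
    (T : R -> Omega -> Omega)
    (hLebesgue : lebesgue_space mu)
    (hmeas : jointly_measurable mu T)
    (hmp : forall t : R, measure_preserving mu (T t))
    (hflow : forall t s : R, T t \o T s = T (t + s))
    (f : Omega -> R[i])
    (hf : Cintegrable mu setT f) :
  exists N : set Omega,
    mu.-negligible N /\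
    forall w : Omega, ~ N w -> forall theta : R,
      (forall tau : R, 0 < tau ->
         Cintegrable (@completed_lebesgue_measure R) `[0, tau]%classic
           (twisted_orbit T f w theta)) /\
      exists l : R[i]^o, twisted_average T f w theta tau @[tau --> +oo] --> l.
Proof.
have [hfr hfi] := hf.
have wwr := wiener_wintner_flow hmeas hmp hflow hfr.
have wwi := wiener_wintner_flow hmeas hmp hflow hfi.
have [N [mN N0 good]] : {ae mu, forall w, forall theta : R,
      (forall tau : R, 0 < tau ->
         Cintegrable (@completed_lebesgue_measure R) `[0, tau]%classic
           (twisted_orbit T f w theta)) /\
      exists l : R[i]^o, twisted_average T f w theta tau @[tau --> +oo] --> l}.
  apply: filterS2 wwr wwi => w wr wi theta.
  (* Phase 0 gives the cosine part and phase [- (pi / 2)] the sine part of the product with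
     [expi]. *)
  have [ir [lr cr]] := wr theta 0.
  have [ir' [lr' cr']] := wr theta (- (pi / 2)).
  have [ii [li ci]] := wi theta 0.
  have [ii' [li' ci']] := wi theta (- (pi / 2)).
  pose A t := complex.Re (f (T t w)) * cos (2 * pi * theta * t + 0).
  pose A' t := complex.Re (f (T t w)) * cos (2 * pi * theta * t + - (pi / 2)).
  pose B t := complex.Im (f (T t w)) * cos (2 * pi * theta * t + 0).
  pose B' t := complex.Im (f (T t w)) * cos (2 * pi * theta * t + - (pi / 2)).
  have ReE : (fun t => complex.Re (twisted_orbit T f w theta t)) = fun t => A t - B' t.
    apply/funext => t; rewrite /twisted_orbit /A /B' addr0 cosBpihalf.
    by case: (f (T t w)).
  have ImE : (fun t => complex.Im (twisted_orbit T f w theta t)) = fun t => A' t + B t.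
    apply/funext => t; rewrite /twisted_orbit /A' /B addr0 cosBpihalf.
    by case: (f (T t w)).
  have mseg (tau : R) : measurable (`[0, tau]%classic :
      set (caratheodory_type (wlength (@idfun R))^*%mu)).
    by apply: sub_caratheodory; exact: measurable_itv.
  split.
    move=> tau _; split.
      rewrite (_ : (fun x => _) = EFin \o fun t => A t - B' t); last first.
        by rewrite -ReE.
      exact: (integrableB (mseg tau) (ir tau) (ii' tau)).
    rewrite (_ : (fun x => _) = EFin \o fun t => A' t + B t); last first.
      by rewrite -ImE.
    exact: (integrableD (mseg tau) (ir' tau) (ii tau)).
  exists ((lr - li') +i* (lr' + li)).
  rewrite (_ : twisted_average T f w theta = fun tau =>
    (tau^-1 * Rintegral (@completed_lebesgue_measure R) `[0, tau]%classic A -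
     tau^-1 * Rintegral (@completed_lebesgue_measure R) `[0, tau]%classic B') +i*
    (tau^-1 * Rintegral (@completed_lebesgue_measure R) `[0, tau]%classic A' +
     tau^-1 * Rintegral (@completed_lebesgue_measure R) `[0, tau]%classic B)).
    by apply: cvg_complex; [exact: cvgB|exact: cvgD].
  apply/funext => tau; rewrite /twisted_average /Cintegral ReE ImE.
  rewrite (RintegralB (mseg tau) (ir tau) (ii' tau)).
  rewrite (RintegralD (mseg tau) (ir' tau) (ii tau)) -mulrBr -mulrDr.
  by apply/eqP; rewrite eq_complex /= !mul0r addr0 subr0 !eqxx.
exists N; split; first by exists N; split.
by move=> w nN; apply: contrapT => bad; apply: nN; exact: good.
Qed.
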